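(* Let $\Bbbk$ be an algebraically closed field of characteristic $0$, let $\Gamma$ be an abelian group, and let $\mathbb{V}$ be a Yetter-Drinfeld module over the group algebra $\Bbbk\Gamma$ whose dimension is infinite and countable. If $\operatorname{GKdim}\mathscr{B}(\mathbb{V})<\infty$, then $\mathbb{V}$ is a locally finite braided vector space.
   Context: A Yetter-Drinfeld module over $\Bbbk\Gamma$, for $\Gamma$ abelian, is a $\Gamma$-graded $\Gamma$-module $\mathbb{V}=\bigoplus_{g\in\Gamma}\mathbb{V}_g$ (the action of $\Gamma$ preserves each $\mathbb{V}_g$); it is a braided vector space with $c(v\otimes w)=g\cdot w\otimes v$ for $v\in\mathbb{V}_g$, $w\in\mathbb{V}$. $\mathscr{B}(\mathbb{V})$ is the Nichols algebra of the braided vector space $\mathbb{V}$, and $\operatorname{GKdim}$ is the Gelfand-Kirillov dimension. A braided subspace of a braided vector space $(V,c)$ is a subspace $W$ such that $c$ restricts to an automorphism of $W\otimes W$. A family $\mathfrak{F}$ of elements of a partially ordered set $(\mathscr{X},\prec)$ is filtered if for all $U,W\in\mathfrak{F}$ there is $Z\in\mathfrak{F}$ with $U\prec Z$ and $W\prec Z$. A braided vector space is locally finite if it is the union of its finite-dimensional braided subspaces and these form a filtered family with respect to inclusion. *)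

(* Defs.v *)
From HB Require Import structures.
From mathcomp Require Import all_boot all_order all_algebra.
From mathcomp Require Import finmap.
From mathcomp Require Import boolp classical_sets reals ereal sequences exp.

Set Implicit Arguments.
Unset Strict Implicit.
Unset Printing Implicit Defensive.

Import Order.TTheory GRing.Theory Num.Theory.

Local Open Scope classical_set_scope.
Local Open Scope ring_scope.
Local Open Scope quotient_scope.

(* ------------------------------------------------------------------ *)
Section LinearAlgebra.
Context (k : fieldType) (V : lmodType k).

Definition subspace (W : set V) : Prop :=
  W 0 /\ forall (a : k) u v, W u -> W v -> W (a *: u + v).

Definition span (X : set V) : set V := smallest subspace X.

Definition lin_free (I : eqType) (e : I -> V) : Prop :=
  forall (s : seq I) (a : I -> k), uniq s ->
    \sum_(i <- s) a i *: e i = 0 -> forall i, i \in s -> a i = 0.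

Definition is_basis (I : eqType) (e : I -> V) (W : set V) : Prop :=
  lin_free e /\ span (range e) = W.

Definition fin_dim (W : set V) : Prop :=
  exists n, exists e : 'I_n -> V, is_basis e W.

(* Only meaningful when [fin_dim W]; it is 0 otherwise. *)
Definition dim (W : set V) : nat :=
  xget 0%N [set n | exists e : 'I_n -> V, is_basis e W].

Definition countably_infinite_dim : Prop :=
  exists e : nat -> V, is_basis e setT.

End LinearAlgebra.
Arguments countably_infinite_dim {k} V.

(* ------------------------------------------------------------------ *)
Section GKdim.
Context (R : realType) (k : fieldType) (A : algType k).

(* k + W + W^2 + ... + W^n *)
Definition pow_le (W : set A) (n : nat) : set A :=
  span [set x | exists s : seq A,
    [/\ (size s <= n)%N, forall y, y \in s -> W y & x = \prod_(y <- s) y]].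

Definition GKdim : \bar R :=
  ereal_sup [set limn_esup
               (fun n => (ln (dim (pow_le W n))%:R / ln n%:R)%:E)
            | W in [set W : set A | fin_dim W]].

End GKdim.

(* ------------------------------------------------------------------ *)
(* The tensor product [tens V W], presented by the generators [v (x) w]
   and the relations of a [k]-module together with bilinearity. *)
Section Tensor.
Context (k : fieldType) (V W : lmodType k).

Inductive tens_expr : Type :=
| TEpure of V & W
| TEzero
| TEadd of tens_expr & tens_expr
| TEscale of k & tens_expr.

Inductive tens_eq : tens_expr -> tens_expr -> Prop :=
| te_refl x : tens_eq x x
| te_sym x y : tens_eq x y -> tens_eq y x
| te_trans x y z : tens_eq x y -> tens_eq y z -> tens_eq x z
| te_add x x' y y' :
    tens_eq x x' -> tens_eq y y' -> tens_eq (TEadd x y) (TEadd x' y')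
| te_scale a x x' : tens_eq x x' -> tens_eq (TEscale a x) (TEscale a x')
| te_addA x y z : tens_eq (TEadd x (TEadd y z)) (TEadd (TEadd x y) z)
| te_addC x y : tens_eq (TEadd x y) (TEadd y x)
| te_add0 x : tens_eq (TEadd TEzero x) x
| te_addN x : tens_eq (TEadd (TEscale (-1) x) x) TEzero
| te_scaleA a b x : tens_eq (TEscale a (TEscale b x)) (TEscale (a * b) x)
| te_scale1 x : tens_eq (TEscale 1 x) x
| te_scaleDr a x y :
    tens_eq (TEscale a (TEadd x y)) (TEadd (TEscale a x) (TEscale a y))
| te_scaleDl a b x :
    tens_eq (TEscale (a + b) x) (TEadd (TEscale a x) (TEscale b x))
| te_linl a v v' w :
    tens_eq (TEpure (a *: v + v') w)
            (TEadd (TEscale a (TEpure v w)) (TEpure v' w))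
| te_linr a v w w' :
    tens_eq (TEpure v (a *: w + w'))
            (TEadd (TEscale a (TEpure v w)) (TEpure v w')).

HB.instance Definition _ := gen_eqMixin tens_expr.
HB.instance Definition _ := gen_choiceMixin tens_expr.

Definition tens_eqb : rel tens_expr := fun x y => `[< tens_eq x y >].

Lemma tens_eqb_equiv : equiv_class_of tens_eqb.
Proof.
split=> [x|x y|y x z].
- exact/asboolP/te_refl.
- by apply/asboolP/asboolP => /te_sym.
- by move=> /asboolP xy /asboolP yz; apply/asboolP/(te_trans xy yz).
Qed.

Canonical tens_equiv := EquivRelPack tens_eqb_equiv.

Definition tens := {eq_quot tens_equiv}.
HB.instance Definition _ := Choice.on tens.

Definition tens_pi (x : tens_expr) : tens := \pi_tens x.

Lemma tens_piP x y : tens_eq x y <-> tens_pi x = tens_pi y.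
Proof.
split=> [xy|/eqmodP /asboolP //]; first by apply/eqmodP/asboolP.
Qed.

Lemma tens_pi_repr (x : tens) : tens_pi (repr x) = x.
Proof. exact: reprK. Qed.

Lemma tens_repr_pi x : tens_eq (repr (tens_pi x)) x.
Proof. by apply/tens_piP; rewrite tens_pi_repr. Qed.

Definition tens_add (x y : tens) := tens_pi (TEadd (repr x) (repr y)).
Definition tens_scale a (x : tens) := tens_pi (TEscale a (repr x)).
Definition tens_opp (x : tens) := tens_scale (-1) x.

Lemma tens_addE x y : tens_add (tens_pi x) (tens_pi y) = tens_pi (TEadd x y).
Proof. by apply/tens_piP/te_add; exact: tens_repr_pi. Qed.

Lemma tens_scaleE a x : tens_scale a (tens_pi x) = tens_pi (TEscale a x).
Proof. by apply/tens_piP/te_scale; exact: tens_repr_pi. Qed.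

Lemma tens_ind_pi (P : tens -> Prop) : (forall x, P (tens_pi x)) -> forall x, P x.
Proof. by move=> Ppi x; rewrite -(tens_pi_repr x). Qed.

Lemma tens_addA : associative tens_add.
Proof.
elim/tens_ind_pi=> x; elim/tens_ind_pi=> y; elim/tens_ind_pi=> z.
by rewrite !tens_addE; apply/tens_piP/te_addA.
Qed.
Lemma tens_addC : commutative tens_add.
Proof.
elim/tens_ind_pi=> x; elim/tens_ind_pi=> y.
by rewrite !tens_addE; apply/tens_piP/te_addC.
Qed.
Lemma tens_add0 : left_id (tens_pi TEzero) tens_add.
Proof. by elim/tens_ind_pi=> x; rewrite !tens_addE; apply/tens_piP/te_add0. Qed.
Lemma tens_addN : left_inverse (tens_pi TEzero) tens_opp tens_add.
Proof.
elim/tens_ind_pi=> x.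
by rewrite /tens_opp tens_scaleE tens_addE; apply/tens_piP/te_addN.
Qed.

HB.instance Definition _ :=
  GRing.isZmodule.Build tens tens_addA tens_addC tens_add0 tens_addN.

Lemma tens_pi_add x y : tens_pi x + tens_pi y = tens_pi (TEadd x y).
Proof. exact: tens_addE. Qed.

Lemma tens_scaleA a b x :
  tens_scale a (tens_scale b x) = tens_scale (a * b) x.
Proof.
by elim/tens_ind_pi: x=> x; rewrite !tens_scaleE; apply/tens_piP/te_scaleA.
Qed.
Lemma tens_scale1 : left_id 1 tens_scale.
Proof. by elim/tens_ind_pi=> x; rewrite tens_scaleE; apply/tens_piP/te_scale1. Qed.
Lemma tens_scaleDr : right_distributive tens_scale +%R.
Proof.
move=> a; elim/tens_ind_pi=> x; elim/tens_ind_pi=> y.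
rewrite tens_pi_add !tens_scaleE tens_pi_add.
exact/tens_piP/te_scaleDr.
Qed.
Lemma tens_scaleDl x : {morph tens_scale^~ x : a b / a + b}.
Proof.
elim/tens_ind_pi: x=> x a b.
rewrite !tens_scaleE tens_pi_add.
exact/tens_piP/te_scaleDl.
Qed.

HB.instance Definition _ := GRing.Zmodule_isLmodule.Build k tens
  tens_scaleA tens_scale1 tens_scaleDr tens_scaleDl.

Lemma tens_pi_scale a x : a *: tens_pi x = tens_pi (TEscale a x).
Proof. exact: tens_scaleE. Qed.

Definition pure (v : V) (w : W) : tens := tens_pi (TEpure v w).

Lemma pure_linl w : linear (pure^~ w).
Proof.
by move=> a v v'; rewrite tens_pi_scale tens_pi_add; apply/tens_piP/te_linl.
Qed.
Lemma pure_linr v : linear (pure v).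
Proof.
by move=> a w w'; rewrite tens_pi_scale tens_pi_add; apply/tens_piP/te_linr.
Qed.

Lemma tens_ind (P : tens -> Prop) :
  (forall v w, P (pure v w)) -> P 0 ->
  (forall x y, P x -> P y -> P (x + y)) ->
  (forall a x, P x -> P (a *: x)) -> forall x, P x.
Proof.
move=> Pp P0 PD PZ; elim/tens_ind_pi; elim=> [v w||x IHx y IHy|a x IHx].
- exact: Pp.
- exact: P0.
- by rewrite -tens_pi_add; apply: PD.
- by rewrite -tens_pi_scale; apply: PZ.
Qed.

Section Lift.
Context (U : lmodType k) (f : V -> W -> U).

Fixpoint tens_eval (x : tens_expr) : U :=
  match x with
  | TEpure v w => f v w
  | TEzero => 0
  | TEadd x y => tens_eval x + tens_eval y
  | TEscale a x => a *: tens_eval x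
  end.

(* The linear map induced by [f], provided that [f] is bilinear. *)
Definition tens_lift (x : tens) : U := tens_eval (repr x).

Hypothesis flinl : forall w, linear (f^~ w).
Hypothesis flinr : forall v, linear (f v).

Lemma tens_eval_eq x y : tens_eq x y -> tens_eval x = tens_eval y.
Proof.
elim=> //=.
- by move=> {}x {}y z _ -> _ ->.
- by move=> {}x x' {}y y' _ -> _ ->.
- by move=> a {}x x' _ ->.
- by move=> *; rewrite addrA.
- by move=> *; rewrite addrC.
- by move=> *; rewrite add0r.
- by move=> {}x; rewrite scaleN1r addNr.
- by move=> *; rewrite scalerA.
- by move=> *; rewrite scale1r.
- by move=> *; rewrite scalerDr.
- by move=> *; rewrite scalerDl.
- by move=> *; rewrite flinl.
- by move=> *; rewrite flinr.
Qed.

Lemma tens_lift_pi x : tens_lift (tens_pi x) = tens_eval x.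
Proof. exact/tens_eval_eq/tens_repr_pi. Qed.

Lemma tens_lift_pure v w : tens_lift (pure v w) = f v w.
Proof. exact: tens_lift_pi. Qed.

Lemma tens_lift_linear : linear tens_lift.
Proof.
move=> a; elim/tens_ind_pi=> x; elim/tens_ind_pi=> y.
by rewrite tens_pi_scale tens_pi_add !tens_lift_pi.
Qed.

End Lift.
End Tensor.

(* ------------------------------------------------------------------ *)
(* The tensor algebra [talg V], presented by the generators [V] and the
   relations of a [k]-algebra together with linearity of [V -> talg V]. *)
Section TensorAlgebra.
Context (k : fieldType) (V : lmodType k).

Inductive talg_expr : Type :=
| TAgen of V
| TAone
| TAzero
| TAadd of talg_expr & talg_expr
| TAmul of talg_expr & talg_expr
| TAscale of k & talg_expr.

Inductive talg_eq : talg_expr -> talg_expr -> Prop :=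
| ta_refl x : talg_eq x x
| ta_sym x y : talg_eq x y -> talg_eq y x
| ta_trans x y z : talg_eq x y -> talg_eq y z -> talg_eq x z
| ta_add x x' y y' :
    talg_eq x x' -> talg_eq y y' -> talg_eq (TAadd x y) (TAadd x' y')
| ta_mul x x' y y' :
    talg_eq x x' -> talg_eq y y' -> talg_eq (TAmul x y) (TAmul x' y')
| ta_scale a x x' : talg_eq x x' -> talg_eq (TAscale a x) (TAscale a x')
| ta_addA x y z : talg_eq (TAadd x (TAadd y z)) (TAadd (TAadd x y) z)
| ta_addC x y : talg_eq (TAadd x y) (TAadd y x)
| ta_add0 x : talg_eq (TAadd TAzero x) x
| ta_addN x : talg_eq (TAadd (TAscale (-1) x) x) TAzero
| ta_scaleA a b x : talg_eq (TAscale a (TAscale b x)) (TAscale (a * b) x)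
| ta_scale1 x : talg_eq (TAscale 1 x) x
| ta_scaleDr a x y :
    talg_eq (TAscale a (TAadd x y)) (TAadd (TAscale a x) (TAscale a y))
| ta_scaleDl a b x :
    talg_eq (TAscale (a + b) x) (TAadd (TAscale a x) (TAscale b x))
| ta_mulA x y z : talg_eq (TAmul x (TAmul y z)) (TAmul (TAmul x y) z)
| ta_mul1l x : talg_eq (TAmul TAone x) x
| ta_mul1r x : talg_eq (TAmul x TAone) x
| ta_mulDl x y z : talg_eq (TAmul (TAadd x y) z) (TAadd (TAmul x z) (TAmul y z))
| ta_mulDr x y z : talg_eq (TAmul x (TAadd y z)) (TAadd (TAmul x y) (TAmul x z))
| ta_scaleAl a x y : talg_eq (TAscale a (TAmul x y)) (TAmul (TAscale a x) y)
| ta_scaleAr a x y : talg_eq (TAscale a (TAmul x y)) (TAmul x (TAscale a y))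
| ta_lin a v w :
    talg_eq (TAgen (a *: v + w)) (TAadd (TAscale a (TAgen v)) (TAgen w)).

Definition multilinear (U : lmodType k) (F : seq V -> U) : Prop :=
  forall s1 s2, linear (fun v => F (s1 ++ v :: s2)).

Section Eval.
Context (U : lmodType k).

Fixpoint talg_eval (x : talg_expr) (F : seq V -> U) : seq V -> U :=
  match x with
  | TAgen v => fun s => F (rcons s v)
  | TAone => F
  | TAzero => fun=> 0
  | TAadd x y => fun s => talg_eval x F s + talg_eval y F s
  | TAmul x y => talg_eval x (talg_eval y F)
  | TAscale a x => fun s => a *: talg_eval x F s
  end.

Lemma talg_eval_multilinear x F : multilinear F -> multilinear (talg_eval x F).
Proof.
elim: x F => [v|||x IHx y IHy|x IHx y IHy|b x IHx] F FL //= s1 s2 a u u'.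
- by rewrite !rcons_cat !rcons_cons FL.
- by rewrite scaler0 addr0.
- by rewrite IHx // IHy // scalerDr addrACA.
- by rewrite IHx //; exact: IHy.
- by rewrite IHx // scalerDr !scalerA mulrC.
Qed.

Lemma talg_evalP x F G a :
  talg_eval x (fun s => a *: F s + G s) =
  (fun s => a *: talg_eval x F s + talg_eval x G s).
Proof.
elim: x F G => [v|||x IHx y IHy|x IHx y IHy|b x IHx] F G //=; apply/funext=> s.
- by rewrite scaler0 addr0.
- by rewrite IHx IHy scalerDr addrACA.
- by rewrite IHy IHx.
- by rewrite IHx scalerDr !scalerA mulrC.
Qed.

Lemma talg_eval_eq x y F :
  multilinear F -> talg_eq x y -> talg_eval x F = talg_eval y F.
Proof.
move=> FL xy; elim: xy F FL => //=; clear x y.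
- by move=> x y _ IH F FL; rewrite IH.
- by move=> x y z _ IH1 _ IH2 F FL; rewrite IH1 ?IH2.
- by move=> x x' y y' _ IH1 _ IH2 F FL; rewrite IH1 ?IH2.
- by move=> x x' y y' _ IH1 _ IH2 F FL; rewrite IH2 // IH1 //;
    exact: talg_eval_multilinear.
- by move=> a x x' _ IH F FL; rewrite IH.
- by move=> x y z F _; apply/funext=> s; rewrite addrA.
- by move=> x y F _; apply/funext=> s; rewrite addrC.
- by move=> x F _; apply/funext=> s; rewrite add0r.
- by move=> x F _; apply/funext=> s; rewrite scaleN1r addNr.
- by move=> a b x F _; apply/funext=> s; rewrite scalerA.
- by move=> x F _; apply/funext=> s; rewrite scale1r.
- by move=> a x y F _; apply/funext=> s; rewrite scalerDr.
- by move=> a b x F _; apply/funext=> s; rewrite scalerDl.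
- move=> x y z F _; have := talg_evalP x (talg_eval y F) (talg_eval z F) 1.
  have -> : (fun s => 1 *: talg_eval y F s + talg_eval z F s) =
            (fun s => talg_eval y F s + talg_eval z F s).
    by apply/funext=> s; rewrite scale1r.
  by move=> ->; apply/funext=> s; rewrite scale1r.
- move=> a x y F _; have := talg_evalP x (talg_eval y F) (fun=> 0) a.
  have -> : (fun s => a *: talg_eval y F s + 0) = (fun s => a *: talg_eval y F s).
    by apply/funext=> s; rewrite addr0.
  move=> ->; apply/funext=> s.
  suff -> : talg_eval x (fun=> 0) s = 0 :> U by rewrite addr0.
  have := talg_evalP x F F (-1).
  have -> : (fun s => -1 *: F s + F s) = (fun=> 0).
    by apply/funext=> t; rewrite scaleN1r addNr.
  by move=> ->; rewrite scaleN1r addNr.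
- by move=> a v w F FL; apply/funext=> s; rewrite -!cats1 FL.
Qed.

End Eval.

HB.instance Definition _ := gen_eqMixin talg_expr.
HB.instance Definition _ := gen_choiceMixin talg_expr.

Definition talg_eqb : rel talg_expr := fun x y => `[< talg_eq x y >].

Lemma talg_eqb_equiv : equiv_class_of talg_eqb.
Proof.
split=> [x|x y|y x z].
- exact/asboolP/ta_refl.
- by apply/asboolP/asboolP => /ta_sym.
- by move=> /asboolP xy /asboolP yz; apply/asboolP/(ta_trans xy yz).
Qed.

Canonical talg_equiv := EquivRelPack talg_eqb_equiv.

Definition talg := {eq_quot talg_equiv}.
HB.instance Definition _ := Choice.on talg.

Definition talg_pi (x : talg_expr) : talg := \pi_talg x.

Lemma talg_piP x y : talg_eq x y <-> talg_pi x = talg_pi y.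
Proof. by split=> [xy|/eqmodP /asboolP //]; apply/eqmodP/asboolP. Qed.

Lemma talg_pi_repr (x : talg) : talg_pi (repr x) = x.
Proof. exact: reprK. Qed.

Lemma talg_repr_pi x : talg_eq (repr (talg_pi x)) x.
Proof. by apply/talg_piP; rewrite talg_pi_repr. Qed.

Lemma talg_ind_pi (P : talg -> Prop) : (forall x, P (talg_pi x)) -> forall x, P x.
Proof. by move=> Ppi x; rewrite -(talg_pi_repr x). Qed.

Definition talg_add (x y : talg) := talg_pi (TAadd (repr x) (repr y)).
Definition talg_mul (x y : talg) := talg_pi (TAmul (repr x) (repr y)).
Definition talg_scale a (x : talg) := talg_pi (TAscale a (repr x)).
Definition talg_opp (x : talg) := talg_scale (-1) x.

Lemma talg_addE x y : talg_add (talg_pi x) (talg_pi y) = talg_pi (TAadd x y).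
Proof. by apply/talg_piP/ta_add; exact: talg_repr_pi. Qed.
Lemma talg_mulE x y : talg_mul (talg_pi x) (talg_pi y) = talg_pi (TAmul x y).
Proof. by apply/talg_piP/ta_mul; exact: talg_repr_pi. Qed.
Lemma talg_scaleE a x : talg_scale a (talg_pi x) = talg_pi (TAscale a x).
Proof. by apply/talg_piP/ta_scale; exact: talg_repr_pi. Qed.

Lemma talg_addA : associative talg_add.
Proof.
elim/talg_ind_pi=> x; elim/talg_ind_pi=> y; elim/talg_ind_pi=> z.
by rewrite !talg_addE; apply/talg_piP/ta_addA.
Qed.
Lemma talg_addC : commutative talg_add.
Proof.
elim/talg_ind_pi=> x; elim/talg_ind_pi=> y.
by rewrite !talg_addE; apply/talg_piP/ta_addC.
Qed.
Lemma talg_add0 : left_id (talg_pi TAzero) talg_add.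
Proof. by elim/talg_ind_pi=> x; rewrite !talg_addE; apply/talg_piP/ta_add0. Qed.
Lemma talg_addN : left_inverse (talg_pi TAzero) talg_opp talg_add.
Proof.
elim/talg_ind_pi=> x.
by rewrite /talg_opp talg_scaleE talg_addE; apply/talg_piP/ta_addN.
Qed.

HB.instance Definition _ :=
  GRing.isZmodule.Build talg talg_addA talg_addC talg_add0 talg_addN.

Lemma talg_pi_add x y : talg_pi x + talg_pi y = talg_pi (TAadd x y).
Proof. exact: talg_addE. Qed.

Lemma talg_mulA : associative talg_mul.
Proof.
elim/talg_ind_pi=> x; elim/talg_ind_pi=> y; elim/talg_ind_pi=> z.
by rewrite !talg_mulE; apply/talg_piP/ta_mulA.
Qed.
Lemma talg_mul1l : left_id (talg_pi TAone) talg_mul.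
Proof. by elim/talg_ind_pi=> x; rewrite talg_mulE; apply/talg_piP/ta_mul1l. Qed.
Lemma talg_mul1r : right_id (talg_pi TAone) talg_mul.
Proof. by elim/talg_ind_pi=> x; rewrite talg_mulE; apply/talg_piP/ta_mul1r. Qed.
Lemma talg_mulDl : left_distributive talg_mul +%R.
Proof.
elim/talg_ind_pi=> x; elim/talg_ind_pi=> y; elim/talg_ind_pi=> z.
by rewrite talg_pi_add !talg_mulE talg_pi_add; apply/talg_piP/ta_mulDl.
Qed.
Lemma talg_mulDr : right_distributive talg_mul +%R.
Proof.
elim/talg_ind_pi=> x; elim/talg_ind_pi=> y; elim/talg_ind_pi=> z.
by rewrite talg_pi_add !talg_mulE talg_pi_add; apply/talg_piP/ta_mulDr.
Qed.
Lemma talg_one_neq0 : talg_pi TAone != 0.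
Proof.
pose F (s : seq V) : k^o := (size s == 0)%:R.
have FL : multilinear F.
  by move=> s1 s2 a u v; rewrite /F !size_cat /= !addnS scaler0 addr0.
apply/eqP=> /talg_piP /(talg_eval_eq FL) /(congr1 (@^~ [::])) /=.
by rewrite /F eqxx => /eqP; rewrite oner_eq0.
Qed.

HB.instance Definition _ := GRing.Zmodule_isNzRing.Build talg
  talg_mulA talg_mul1l talg_mul1r talg_mulDl talg_mulDr talg_one_neq0.

Lemma talg_pi_mul x y : talg_pi x * talg_pi y = talg_pi (TAmul x y).
Proof. exact: talg_mulE. Qed.

Lemma talg_scaleA a b x :
  talg_scale a (talg_scale b x) = talg_scale (a * b) x.
Proof.
by elim/talg_ind_pi: x=> x; rewrite !talg_scaleE; apply/talg_piP/ta_scaleA.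
Qed.
Lemma talg_scale1 : left_id 1 talg_scale.
Proof. by elim/talg_ind_pi=> x; rewrite talg_scaleE; apply/talg_piP/ta_scale1. Qed.
Lemma talg_scaleDr : right_distributive talg_scale +%R.
Proof.
move=> a; elim/talg_ind_pi=> x; elim/talg_ind_pi=> y.
by rewrite talg_pi_add !talg_scaleE talg_pi_add; apply/talg_piP/ta_scaleDr.
Qed.
Lemma talg_scaleDl x : {morph talg_scale^~ x : a b / a + b}.
Proof.
elim/talg_ind_pi: x=> x a b.
by rewrite !talg_scaleE talg_pi_add; apply/talg_piP/ta_scaleDl.
Qed.

HB.instance Definition _ := GRing.Zmodule_isLmodule.Build k talg
  talg_scaleA talg_scale1 talg_scaleDr talg_scaleDl.

Lemma talg_pi_scale a x : a *: talg_pi x = talg_pi (TAscale a x).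
Proof. exact: talg_scaleE. Qed.

Lemma talg_scaleAl a (x y : talg) : a *: (x * y) = (a *: x) * y.
Proof.
elim/talg_ind_pi: x=> x; elim/talg_ind_pi: y=> y.
by rewrite talg_pi_mul !talg_pi_scale talg_pi_mul; apply/talg_piP/ta_scaleAl.
Qed.
HB.instance Definition _ := GRing.Lmodule_isLalgebra.Build k talg talg_scaleAl.

Lemma talg_scaleAr a (x y : talg) : a *: (x * y) = x * (a *: y).
Proof.
elim/talg_ind_pi: x=> x; elim/talg_ind_pi: y=> y.
by rewrite talg_pi_mul !talg_pi_scale talg_pi_mul; apply/talg_piP/ta_scaleAr.
Qed.
HB.instance Definition _ := GRing.Lalgebra_isAlgebra.Build k talg talg_scaleAr.

Definition tgen (v : V) : talg := talg_pi (TAgen v).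

Lemma tgen_linear : linear tgen.
Proof.
by move=> a v w; rewrite talg_pi_scale talg_pi_add; apply/talg_piP/ta_lin.
Qed.
HB.instance Definition _ := GRing.isLinear.Build k V talg _ tgen tgen_linear.

Definition tword (s : seq V) : talg := \prod_(v <- s) tgen v.

Lemma tword_multilinear : multilinear tword.
Proof.
move=> s1 s2 a v w; rewrite /tword !big_cat !big_cons /= linearP.
by rewrite mulrDl mulrDr -scalerAl -scalerAr.
Qed.

Lemma talg_ind (P : talg -> Prop) :
  (forall s, P (tword s)) ->
  (forall a x y, P x -> P y -> P (a *: x + y)) -> forall x, P x.
Proof.
move=> Pw PL.
have P0 : P 0.
  by have := PL (-1) _ _ (Pw [::]) (Pw [::]); rewrite scaleN1r addNr.
suff lcW x : exists l : seq (k * seq V), x = \sum_(p <- l) p.1 *: tword p.2.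
  move=> x; have [l ->] := lcW x; elim: l => [|p l IHl]; first by rewrite big_nil.
  by rewrite big_cons; apply: PL.
have lcw s : exists l : seq (k * seq V), tword s = \sum_(p <- l) p.1 *: tword p.2.
  by exists [:: (1, s)]; rewrite big_seq1 scale1r.
elim/talg_ind_pi: x; elim=> [v|||x [l xE] y [m yE]|x [l xE] y [m yE]|a x [l xE]].
- by have [l lE] := lcw [:: v]; exists l; rewrite -lE /tword big_seq1.
- by have [l lE] := lcw [::]; exists l; rewrite -lE /tword big_nil.
- by exists [::]; rewrite big_nil.
- by exists (l ++ m); rewrite big_cat /= -xE -yE talg_pi_add.
- exists [seq (p.1 * q.1, p.2 ++ q.2) | p <- l, q <- m].
  rewrite -talg_pi_mul xE yE mulr_suml big_allpairs_dep /=.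
  apply: eq_bigr => p _; rewrite mulr_sumr; apply: eq_bigr => q _ /=.
  by rewrite /tword big_cat -scalerAl -scalerAr scalerA.
- exists [seq (a * p.1, p.2) | p <- l]; rewrite -talg_pi_scale xE scaler_sumr.
  by rewrite big_map; apply: eq_bigr => p _; rewrite scalerA.
Qed.

Section Lift.
Context (U : lmodType k) (F : seq V -> U).

(* The linear map with [tword s |-> F s], provided that [F] is multilinear. *)
Definition talg_lift (x : talg) : U := talg_eval (repr x) F [::].

Hypothesis FL : multilinear F.

Lemma talg_lift_pi x : talg_lift (talg_pi x) = talg_eval x F [::].
Proof. by rewrite /talg_lift (talg_eval_eq FL (talg_repr_pi x)). Qed.

Lemma talg_lift_linear : linear talg_lift.
Proof.
move=> a; elim/talg_ind_pi=> x; elim/talg_ind_pi=> y.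
by rewrite talg_pi_scale talg_pi_add !talg_lift_pi.
Qed.

Lemma talg_lift_word s : talg_lift (tword s) = F s.
Proof.
have -> : tword s = talg_pi (foldr (fun v => TAmul (TAgen v)) TAone s).
  by rewrite /tword; elim: s => [|v s IHs]; rewrite ?big_nil ?big_cons ?IHs ?talg_pi_mul.
rewrite talg_lift_pi -[s in RHS]cat0s; elim: s [::] => [|v s IHs] t /=.
  by rewrite cats0.
by rewrite IHs -cat_rcons.
Qed.

End Lift.

End TensorAlgebra.

(* ------------------------------------------------------------------ *)
Section IdealQuotient.
Context (k : fieldType) (A : algType k).

Definition two_sided_ideal (I : set A) : Prop :=
  subspace I /\ forall x y, I y -> I (x * y) /\ I (y * x).

Record proper_ideal := ProperIdeal {
  pideal_set :> set A;
  pidealP : two_sided_ideal pideal_set;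
  pideal_proper : ~ pideal_set 1
}.

Context (I : proper_ideal).

Definition mod_ideal : rel A := fun x y => `[< pideal_set I (x - y) >].

Lemma pideal0 : pideal_set I 0. Proof. by case: (pidealP I) => -[]. Qed.
Lemma pidealZD a x y : pideal_set I x -> pideal_set I y -> pideal_set I (a *: x + y).
Proof. by case: (pidealP I) => -[_ +] _; apply. Qed.
Lemma pidealD x y : pideal_set I x -> pideal_set I y -> pideal_set I (x + y).
Proof. by rewrite -[x in x + _]scale1r; exact: pidealZD. Qed.
Lemma pidealZ a x : pideal_set I x -> pideal_set I (a *: x).
Proof. by rewrite -[_ *: _]addr0 => Ix; apply: pidealZD => //; exact: pideal0. Qed.
Lemma pidealMl x y : pideal_set I y -> pideal_set I (x * y).
Proof. by case: (pidealP I) => _ /(_ x y) + Iy => -[]. Qed.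
Lemma pidealMr x y : pideal_set I y -> pideal_set I (y * x).
Proof. by case: (pidealP I) => _ /(_ x y) + Iy => -[]. Qed.

Lemma mod_ideal_equiv : equiv_class_of mod_ideal.
Proof.
split=> [x|x y|y x z].
- by apply/asboolP; rewrite subrr; exact: pideal0.
- by apply/asboolP/asboolP => /(pidealZ (-1)); rewrite scaleN1r opprB.
- move=> /asboolP xy /asboolP yz; apply/asboolP.
  by have := pidealD xy yz; rewrite addrA subrK.
Qed.

Canonical mod_ideal_equivr := EquivRelPack mod_ideal_equiv.

Definition quot_alg := {eq_quot mod_ideal_equivr}.
HB.instance Definition _ := Choice.on quot_alg.

Definition quot_pi (x : A) : quot_alg := \pi_quot_alg x.

Lemma quot_piP x y : pideal_set I (x - y) <-> quot_pi x = quot_pi y.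
Proof. by split=> [xy|/eqmodP /asboolP //]; apply/eqmodP/asboolP. Qed.

Lemma quot_pi_repr (x : quot_alg) : quot_pi (repr x) = x.
Proof. exact: reprK. Qed.

Lemma quot_repr_pi x : pideal_set I (repr (quot_pi x) - x).
Proof. by apply/quot_piP; rewrite quot_pi_repr. Qed.

Lemma quot_ind_pi (P : quot_alg -> Prop) :
  (forall x, P (quot_pi x)) -> forall x, P x.
Proof. by move=> Ppi x; rewrite -(quot_pi_repr x). Qed.

Definition quot_add (x y : quot_alg) := quot_pi (repr x + repr y).
Definition quot_mul (x y : quot_alg) := quot_pi (repr x * repr y).
Definition quot_scale a (x : quot_alg) := quot_pi (a *: repr x).
Definition quot_opp (x : quot_alg) := quot_scale (-1) x.

Lemma quot_addE x y : quot_add (quot_pi x) (quot_pi y) = quot_pi (x + y).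
Proof. by apply/quot_piP; rewrite opprD addrACA; apply: pidealD; exact: quot_repr_pi. Qed.
Lemma quot_mulE x y : quot_mul (quot_pi x) (quot_pi y) = quot_pi (x * y).
Proof.
apply/quot_piP; set x' := repr _; set y' := repr _.
have -> : x' * y' - x * y = (x' - x) * y' + x * (y' - y).
  by rewrite mulrBl mulrBr addrA subrK.
by apply: pidealD; [apply: pidealMr | apply: pidealMl]; exact: quot_repr_pi.
Qed.
Lemma quot_scaleE a x : quot_scale a (quot_pi x) = quot_pi (a *: x).
Proof. by apply/quot_piP; rewrite -scalerBr; apply: pidealZ; exact: quot_repr_pi. Qed.

Lemma quot_addA : associative quot_add.
Proof.
elim/quot_ind_pi=> x; elim/quot_ind_pi=> y; elim/quot_ind_pi=> z.
by rewrite !quot_addE addrA.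
Qed.
Lemma quot_addC : commutative quot_add.
Proof.
by elim/quot_ind_pi=> x; elim/quot_ind_pi=> y; rewrite !quot_addE addrC.
Qed.
Lemma quot_add0 : left_id (quot_pi 0) quot_add.
Proof. by elim/quot_ind_pi=> x; rewrite quot_addE add0r. Qed.
Lemma quot_addN : left_inverse (quot_pi 0) quot_opp quot_add.
Proof.
by elim/quot_ind_pi=> x; rewrite /quot_opp quot_scaleE quot_addE scaleN1r addNr.
Qed.

HB.instance Definition _ :=
  GRing.isZmodule.Build quot_alg quot_addA quot_addC quot_add0 quot_addN.

Lemma quot_pi_add x y : quot_pi x + quot_pi y = quot_pi (x + y).
Proof. exact: quot_addE. Qed.

Lemma quot_mulA : associative quot_mul.
Proof.
elim/quot_ind_pi=> x; elim/quot_ind_pi=> y; elim/quot_ind_pi=> z.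
by rewrite !quot_mulE mulrA.
Qed.
Lemma quot_mul1l : left_id (quot_pi 1) quot_mul.
Proof. by elim/quot_ind_pi=> x; rewrite quot_mulE mul1r. Qed.
Lemma quot_mul1r : right_id (quot_pi 1) quot_mul.
Proof. by elim/quot_ind_pi=> x; rewrite quot_mulE mulr1. Qed.
Lemma quot_mulDl : left_distributive quot_mul +%R.
Proof.
elim/quot_ind_pi=> x; elim/quot_ind_pi=> y; elim/quot_ind_pi=> z.
by rewrite quot_pi_add !quot_mulE quot_pi_add mulrDl.
Qed.
Lemma quot_mulDr : right_distributive quot_mul +%R.
Proof.
elim/quot_ind_pi=> x; elim/quot_ind_pi=> y; elim/quot_ind_pi=> z.
by rewrite quot_pi_add !quot_mulE quot_pi_add mulrDr.
Qed.
Lemma quot_one_neq0 : quot_pi 1 != 0.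
Proof.
apply/eqP => /quot_piP; rewrite subr0; exact: pideal_proper.
Qed.

HB.instance Definition _ := GRing.Zmodule_isNzRing.Build quot_alg
  quot_mulA quot_mul1l quot_mul1r quot_mulDl quot_mulDr quot_one_neq0.

Lemma quot_pi_mul x y : quot_pi x * quot_pi y = quot_pi (x * y).
Proof. exact: quot_mulE. Qed.

Lemma quot_scaleA a b x :
  quot_scale a (quot_scale b x) = quot_scale (a * b) x.
Proof. by elim/quot_ind_pi: x=> x; rewrite !quot_scaleE scalerA. Qed.
Lemma quot_scale1 : left_id 1 quot_scale.
Proof. by elim/quot_ind_pi=> x; rewrite quot_scaleE scale1r. Qed.
Lemma quot_scaleDr : right_distributive quot_scale +%R.
Proof.
move=> a; elim/quot_ind_pi=> x; elim/quot_ind_pi=> y.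
by rewrite quot_pi_add !quot_scaleE quot_pi_add scalerDr.
Qed.
Lemma quot_scaleDl x : {morph quot_scale^~ x : a b / a + b}.
Proof.
by elim/quot_ind_pi: x=> x a b; rewrite !quot_scaleE quot_pi_add scalerDl.
Qed.

HB.instance Definition _ := GRing.Zmodule_isLmodule.Build k quot_alg
  quot_scaleA quot_scale1 quot_scaleDr quot_scaleDl.

Lemma quot_pi_scale a x : a *: quot_pi x = quot_pi (a *: x).
Proof. exact: quot_scaleE. Qed.

Lemma quot_scaleAl a (x y : quot_alg) : a *: (x * y) = (a *: x) * y.
Proof.
elim/quot_ind_pi: x=> x; elim/quot_ind_pi: y=> y.
by rewrite quot_pi_mul !quot_pi_scale quot_pi_mul scalerAl.
Qed.
HB.instance Definition _ := GRing.Lmodule_isLalgebra.Build k quot_alg quot_scaleAl.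

Lemma quot_scaleAr a (x y : quot_alg) : a *: (x * y) = x * (a *: y).
Proof.
elim/quot_ind_pi: x=> x; elim/quot_ind_pi: y=> y.
by rewrite quot_pi_mul !quot_pi_scale quot_pi_mul scalerAr.
Qed.
HB.instance Definition _ := GRing.Lalgebra_isAlgebra.Build k quot_alg quot_scaleAr.

Lemma quot_pi_linear : linear quot_pi.
Proof. by move=> a x y; rewrite quot_pi_scale quot_pi_add. Qed.
HB.instance Definition _ := GRing.isLinear.Build k A quot_alg _ quot_pi quot_pi_linear.
Lemma quot_pi_monoid_morphism : monoid_morphism quot_pi.
Proof. by split=> // x y; rewrite quot_pi_mul. Qed.
HB.instance Definition _ :=
  GRing.isMonoidMorphism.Build A quot_alg quot_pi quot_pi_monoid_morphism.

End IdealQuotient.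

(* ------------------------------------------------------------------ *)
Section Braiding.
Context (k : fieldType) (V : lmodType k) (c : tens V V -> tens V V).

(* The map V (x) V -> T(V) onto the component of degree 2. *)
Definition tens_talg : tens V V -> talg V :=
  tens_lift (fun v w => tgen v * tgen w).

(* [c] applied to the factors of index [i] and [i.+1] (counted from 0) of the
   pure tensor [s]; words that are too short are left unchanged. *)
Fixpoint braid_word (i : nat) (s : seq V) : talg V :=
  match i, s with
  | 0%N, [:: v, w & s'] => tens_talg (c (pure v w)) * tword s'
  | i'.+1, v :: s' => tgen v * braid_word i' s'
  | _, _ => tword s
  end.

Definition braid_op (i : nat) : talg V -> talg V := talg_lift (braid_word i).

(* One reduced word for each element of the symmetric group S_n, the letter
   [i] standing for the transposition s_i = (i i+1) of {0, ..., n-1}: every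
   element of S_(n+1) is uniquely s_(j-1) ... s_1 s_0 w with 0 <= j <= n and
   [w] in the group generated by s_1, ..., s_(n-1), and lengths add up. *)
Fixpoint reduced_words (n : nat) : seq (seq nat) :=
  if n is n'.+1 then
    [seq rev (iota 0 j) ++ map S w | j <- iota 0 n, w <- reduced_words n']
  else [:: [::]].

(* Quantum symmetrizer: the sum over S_n of the lifts to the braid group of
   the permutations, on the component of degree [n] for every [n]. *)
Definition qsym_word (s : seq V) : talg V :=
  \sum_(w <- reduced_words (size s)) foldr braid_op (tword s) w.

Definition qsym : talg V -> talg V := talg_lift qsym_word.

(* The direct sum of the kernels of the quantum symmetrizers is the kernel of
   [qsym], because [qsym] preserves degrees. For a braiding [c] this kernel is
   already a two-sided ideal. *)
Definition nichols_ideal : set (talg V) :=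
  smallest (@two_sided_ideal k (talg V)) [set x | qsym x = 0].

End Braiding.

Arguments tens_talg {k V}.

Record braidedSpace (k : fieldType) := BraidedSpace {
  braided_sort :> lmodType k;
  braiding : {linear tens braided_sort braided_sort ->
                     tens braided_sort braided_sort};
  braiding_bij : bijective braiding;
  (* the braid equation on V (x) V (x) V, the degree 3 component of T(V) *)
  braiding_eq : forall u v w : braided_sort,
    let c i := braid_op braiding i in
    c 0%N (c 1%N (c 0%N (tword [:: u; v; w]))) =
    c 1%N (c 0%N (c 1%N (tword [:: u; v; w])))
}.

Section Nichols.
Context (k : fieldType) (V : lmodType k)
  (c : {linear tens V V -> tens V V}).

Lemma tens_talg_linear : linear (@tens_talg k V).
Proof.
apply: tens_lift_linear => [w|v] a v1 v2 /=; rewrite linearP.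
  by rewrite mulrDl scalerAl.
by rewrite mulrDr scalerAr.
Qed.
HB.instance Definition _ := GRing.isLinear.Build k (tens V V) (talg V) _
  (@tens_talg k V) tens_talg_linear.

Lemma tens_talg_pure (v w : V) : tens_talg (pure v w) = tgen v * tgen w.
Proof.
apply: tens_lift_pure => [v2|v1] a u1 u2 /=; rewrite linearP.
  by rewrite mulrDl scalerAl.
by rewrite mulrDr scalerAr.
Qed.

Lemma braid_word_multilinear i : multilinear (braid_word c i).
Proof.
elim: i => [|i IHi] s1 s2 a v w.
  case: s1 => [|x [|y s1]].
  - case: s2 => [|y s2] /=; first exact: (tword_multilinear [::] [::]).
    by rewrite pure_linl !linearP mulrDl scalerAl.
  - by rewrite /= pure_linr !linearP mulrDl scalerAl.
  - by rewrite /= (tword_multilinear s1 s2) mulrDr scalerAr.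
case: s1 => [|x s1] /=; first by rewrite linearP mulrDl scalerAl.
by rewrite IHi mulrDr scalerAr.
Qed.

Lemma braid_op_word i s : braid_op c i (tword s) = braid_word c i s.
Proof. exact/talg_lift_word/braid_word_multilinear. Qed.

Lemma braid_op_linear i : linear (braid_op c i).
Proof. exact/talg_lift_linear/braid_word_multilinear. Qed.
HB.instance Definition _ i := GRing.isLinear.Build k (talg V) (talg V) _
  (braid_op c i) (braid_op_linear i).

Lemma qsym_word_multilinear : multilinear (qsym_word c).
Proof.
move=> s1 s2 a v w; rewrite /qsym_word !size_cat /=.
rewrite scaler_sumr -big_split /=; apply: eq_bigr => u _.
elim: u => [|i u IHu] /=; first exact: tword_multilinear.
by rewrite IHu linearP.
Qed.

Lemma qsym_wordE s : qsym c (tword s) = qsym_word c s.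
Proof. exact/talg_lift_word/qsym_word_multilinear. Qed.

Lemma qsym_linear : linear (qsym c).
Proof. exact/talg_lift_linear/qsym_word_multilinear. Qed.
HB.instance Definition _ := GRing.isLinear.Build k (talg V) (talg V) _
  (qsym c) qsym_linear.

Definition talg_counit : talg V -> k^o := talg_lift (fun s => (size s == 0)%:R).

Lemma talg_counit_multilinear : 
  multilinear (fun s : seq V => (size s == 0)%:R : k^o).
Proof. by move=> s1 s2 a u v; rewrite !size_cat /= !addnS scaler0 addr0. Qed.

Lemma talg_counit_word s : talg_counit (tword s) = (size s == 0)%:R.
Proof. exact/talg_lift_word/talg_counit_multilinear. Qed.

Lemma talg_counit_linear : linear talg_counit.
Proof. exact/talg_lift_linear/talg_counit_multilinear. Qed.
HB.instance Definition _ := GRing.isLinear.Build k (talg V) k^o _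
  talg_counit talg_counit_linear.

Lemma talg_counitM x y : talg_counit (x * y) = talg_counit x * talg_counit y.
Proof.
elim/talg_ind: x => [s|a x1 x2 IH1 IH2]; last first.
  by rewrite mulrDl -scalerAl !linearP /= IH1 IH2 mulrDl -scalerAl.
elim/talg_ind: y => [t|a y1 y2 IH1 IH2]; last first.
  by rewrite mulrDr -scalerAr !linearP /= IH1 IH2 mulrDr -scalerAr.
have -> : tword s * tword t = tword (s ++ t) by rewrite /tword big_cat.
rewrite !talg_counit_word size_cat addn_eq0.
by case: (size s == 0)%N; rewrite ?mul1r ?mul0r.
Qed.

Lemma talg_counit_tens t : talg_counit (tens_talg t) = 0.
Proof.
elim/tens_ind: t => [v w||x y IHx IHy|a x IHx].
- rewrite tens_talg_pure.
  by have := talg_counit_word [:: v; w]; rewrite /tword !big_cons big_nil mulr1.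
- by rewrite !linear0.
- by rewrite !linearD /= IHx IHy addr0.
- by rewrite !linearZ /= IHx scaler0.
Qed.

Lemma talg_counit_braid i x : talg_counit (braid_op c i x) = talg_counit x.
Proof.
elim/talg_ind: x => [s|a x y IHx IHy]; last by rewrite !linearP /= IHx IHy.
rewrite braid_op_word talg_counit_word.
case: i s => [|i] [|v [|w s]] //=; rewrite ?talg_counit_word //.
- by rewrite talg_counitM talg_counit_tens mul0r.
- rewrite talg_counitM; have := talg_counit_word [:: v].
  by rewrite /tword big_seq1 => ->; rewrite mul0r.
- rewrite talg_counitM; have := talg_counit_word [:: v].
  by rewrite /tword big_seq1 => ->; rewrite mul0r.
Qed.

Lemma talg_counit_qsym x : talg_counit (qsym c x) = talg_counit x.
Proof.
elim/talg_ind: x => [s|a x y IHx IHy]; last by rewrite !linearP /= IHx IHy.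
have counit_w w : talg_counit (foldr (braid_op c) (tword s) w) =
                  talg_counit (tword s).
  by elim: w => //= i w <-; rewrite talg_counit_braid.
rewrite qsym_wordE linear_sum /= (eq_bigr _ (fun w _ => counit_w w)).
rewrite talg_counit_word; case: s {counit_w} => [|v s]; first by rewrite big_seq1.
by rewrite big1.
Qed.

Lemma nichols_ideal_two_sided : two_sided_ideal (nichols_ideal c).
Proof.
split; first split.
- by move=> I [[[I0 _] _] _].
- move=> a x y Ix Iy I HI; have [[[_ IL] _] _] := HI.
  by apply: IL; [apply: (Ix I)|apply: (Iy I)].
- move=> x y Iy; split=> I HI; have [[_ IM] _] := HI.
  + exact: (IM x y (Iy I HI)).1.
  + exact: (IM x y (Iy I HI)).2.
Qed.

Lemma nichols_ideal_proper : ~ nichols_ideal c 1.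
Proof.
move=> /(_ [set x | talg_counit x = 0]) h.
have : talg_counit 1 = 0.
  apply: h; split; last by move=> x /= qx0; rewrite -talg_counit_qsym qx0 linear0.
  split; first split=> [|a x y /= x0 y0]; rewrite /= ?linear0 //.
    by rewrite linearP /= x0 y0 scaler0 addr0.
  by move=> x y /= y0; rewrite !talg_counitM y0 mulr0 mul0r.
have := talg_counit_word [::]; rewrite /tword big_nil => -> /eqP.
by rewrite oner_eq0.
Qed.

End Nichols.

Definition nichols_proper_ideal (k : fieldType) (V : braidedSpace k) :=
  ProperIdeal (nichols_ideal_two_sided (@braiding k V))
              (nichols_ideal_proper (c := @braiding k V)).

(* The Nichols algebra B(V) = T(V) / J(V). *)
Definition nichols (k : fieldType) (V : braidedSpace k) : algType k :=
  quot_alg (nichols_proper_ideal V).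

(* ------------------------------------------------------------------ *)
Section LocallyFinite.
Context (k : fieldType) (V : braidedSpace k).

(* The image of W (x) W in V (x) V *)
Definition tens_sub (W : set V) : set (tens V V) :=
  span [set t | exists v w, [/\ W v, W w & t = pure v w]].

Definition braided_subspace (W : set V) : Prop :=
  subspace W /\ @braiding k V @` tens_sub W = tens_sub W.

Definition filtered (T : Type) (le : T -> T -> Prop) (F : set T) : Prop :=
  forall U W, F U -> F W -> exists Z, [/\ F Z, le U Z & le W Z].

Definition fin_braided_subspaces : set (set V) :=
  [set W | fin_dim W /\ braided_subspace W].

Definition locally_finite : Prop :=
  \bigcup_(W in fin_braided_subspaces) W = setT /\
  filtered (fun U W : set V => U `<=` W) fin_braided_subspaces.

End LocallyFinite.

(* ------------------------------------------------------------------ *)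
(* The abelian group [G] is written additively. *)
Record ydModule (k : fieldType) (G : zmodType) := YDModule {
  yd_sort :> lmodType k;
  yd_act : G -> {linear yd_sort -> yd_sort};
  yd_act0 : forall v, yd_act 0 v = v;
  yd_actD : forall g h v, yd_act (g + h) v = yd_act g (yd_act h v);
  yd_comp : G -> set yd_sort;
  yd_comp_subspace : forall g, subspace (yd_comp g);
  yd_comp_direct : forall v, exists! f : {fsfun G -> yd_sort with 0},
    (forall g, yd_comp g (f g)) /\ v = \sum_(g <- finsupp f) f g;
  yd_comp_act : forall g h v, yd_comp h v -> yd_comp h (yd_act g v)
}.

Section YDBraiding.
Context (k : fieldType) (G : zmodType) (V : ydModule k G).

Definition yd_dec (v : V) : {fsfun G -> V with 0} :=
  projT1 (cid (yd_comp_direct v)).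

Lemma yd_decP v :
  (forall g, yd_comp g (yd_dec v g)) /\ v = \sum_(g <- finsupp (yd_dec v)) yd_dec v g.
Proof. by rewrite /yd_dec; case: cid => f []. Qed.

Lemma yd_dec_uniq v (f : {fsfun G -> V with 0}) :
  (forall g, yd_comp g (f g)) -> v = \sum_(g <- finsupp f) f g -> yd_dec v = f.
Proof. by move=> fc vE; rewrite /yd_dec; case: cid => /= f' [_]; exact. Qed.

(* c(v (x) w) = sum_g g.w (x) v_g, where v = sum_g v_g with v_g in V_g *)
Definition yd_braiding_fun : tens V V -> tens V V :=
  tens_lift (fun v w =>
    \sum_(g <- finsupp (yd_dec v)) pure (yd_act V g w) (yd_dec v g)).

Lemma yd_comp0 g : yd_comp g (0 : V).
Proof. by case: (yd_comp_subspace V g). Qed.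

Lemma yd_compZD g a (u v : V) :
  yd_comp g u -> yd_comp g v -> yd_comp g (a *: u + v).
Proof. by case: (yd_comp_subspace V g) => _; apply. Qed.

Lemma linear_fun0 (U U' : lmodType k) (f : U -> U') : linear f -> f 0 = 0.
Proof. by move=> fL; have := fL (-1) 0 0; rewrite !scaleN1r !addNr. Qed.

Lemma yd_sumE (U : nmodType) (F : G -> V -> U) (f : {fsfun G -> V with 0})
    (D : {fset G}) :
  (forall g, F g 0 = 0) -> (finsupp f `<=` D)%fset ->
  \sum_(g <- finsupp f) F g (f g) = \sum_(g <- D) F g (f g).
Proof.
move=> F0 sD; apply: big_fset_incl => // g _ gf.
by rewrite fsfun_dflt ?F0.
Qed.

Lemma yd_decZD a u v g : yd_dec (a *: u + v) g = a *: yd_dec u g + yd_dec v g.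
Proof.
have [uc uE] := yd_decP u; have [vc vE] := yd_decP v.
pose D := (finsupp (yd_dec u) `|` finsupp (yd_dec v))%fset.
pose f : {fsfun G -> V with 0} := [fsfun h in D => a *: yd_dec u h + yd_dec v h].
have fE h : f h = a *: yd_dec u h + yd_dec v h.
  rewrite fsfunE; case: ifPn => //; rewrite in_fsetU negb_or => /andP[hu hv].
  by rewrite !fsfun_dflt // scaler0 addr0.
suff -> : yd_dec (a *: u + v) = f by exact: fE.
apply: yd_dec_uniq => [h|].
  by rewrite fE; apply: yd_compZD.
rewrite (yd_sumE (F := fun=> id) (D := D)) //; last first.
  by apply/fsubsetP=> h; rewrite mem_finsupp fsfunE; case: ifP => //; rewrite eqxx.
rewrite (eq_bigr _ (fun h _ => fE h)) big_split /= -scaler_sumr.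
rewrite {1}uE {1}vE; congr (_ *: _ + _); apply: (yd_sumE (F := fun=> id)) => //.
  exact: fsubsetUl.
exact: fsubsetUr.
Qed.

Lemma yd_dec_homog g v : yd_comp g v ->
  yd_dec v = [fsfun h in [fset g]%fset => v] :> {fsfun G -> V with 0}.
Proof.
move=> vg; apply: yd_dec_uniq => [h|].
  by rewrite fsfunE inE; case: eqP => [->|_] //; exact: yd_comp0.
rewrite (yd_sumE (F := fun=> id) (D := [fset g]%fset)) //; last first.
  by apply/fsubsetP=> h; rewrite mem_finsupp fsfunE; case: ifP => //; rewrite eqxx.
by rewrite big_seq_fset1 fsfunE inE eqxx.
Qed.

Lemma yd_sum_homog (U : nmodType) (F : G -> V -> U) g v :
  (forall h, F h 0 = 0) -> yd_comp g v ->
  \sum_(h <- finsupp (yd_dec v)) F h (yd_dec v h) = F g v.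
Proof.
move=> F0 vg; rewrite (yd_sumE (D := [fset g]%fset)) ?big_seq_fset1 //.
  by rewrite (yd_dec_homog vg) fsfunE inE eqxx.
rewrite (yd_dec_homog vg); apply/fsubsetP=> h.
by rewrite mem_finsupp fsfunE; case: ifP => //; rewrite eqxx.
Qed.

Lemma yd_sum_linear (U : lmodType k) (F : G -> V -> U) :
  (forall h, linear (F h)) ->
  linear (fun v => \sum_(h <- finsupp (yd_dec v)) F h (yd_dec v h)).
Proof.
move=> FL a u v; have F0 h : F h 0 = 0 by exact: linear_fun0.
set f := yd_dec (a *: u + v).
pose D := (finsupp f `|` (finsupp (yd_dec u) `|` finsupp (yd_dec v)))%fset.
rewrite !(yd_sumE (D := D)) ?fsubsetUl //; first last.
- by rewrite fsubsetU // fsubsetUl orbT.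
- by rewrite fsubsetU // fsubsetUr orbT.
rewrite scaler_sumr -big_split /=; apply: eq_bigr => h _.
by rewrite /f yd_decZD FL.
Qed.

Lemma yd_ind (P : V -> Prop) :
  (forall g v, yd_comp g v -> P v) ->
  (forall a u v, P u -> P v -> P (a *: u + v)) -> forall v, P v.
Proof.
move=> Ph PL v; have [vc ->] := yd_decP v.
elim/big_ind: _ => [|x y Px Py|g _]; first exact: (Ph 0 0 (yd_comp0 0)).
  by rewrite -[x]scale1r; apply: PL.
exact: Ph (vc g).
Qed.

Lemma yd_braiding_linl w : linear (fun v =>
  \sum_(g <- finsupp (yd_dec v)) pure (yd_act V g w) (yd_dec v g)).
Proof.
by apply: (yd_sum_linear (F := fun g => pure (yd_act V g w))) => g; exact: pure_linr.
Qed.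

Lemma yd_braiding_linr v : linear (fun w =>
  \sum_(g <- finsupp (yd_dec v)) pure (yd_act V g w) (yd_dec v g)).
Proof.
move=> a w w'; rewrite scaler_sumr -big_split /=; apply: eq_bigr => g _.
by rewrite linearP pure_linl.
Qed.

Lemma yd_braiding_linear : linear yd_braiding_fun.
Proof. exact: tens_lift_linear yd_braiding_linl yd_braiding_linr. Qed.
HB.instance Definition _ := GRing.isLinear.Build k (tens V V) (tens V V) _
  yd_braiding_fun yd_braiding_linear.

Definition yd_braiding : {linear tens V V -> tens V V} := yd_braiding_fun.

Lemma yd_braiding_homog g (v w : V) : yd_comp g v ->
  yd_braiding (pure v w) = pure (yd_act V g w) v.
Proof.
move=> vg; rewrite /= /yd_braiding_fun.
rewrite (tens_lift_pure yd_braiding_linl yd_braiding_linr).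
apply: (yd_sum_homog (F := fun g => pure (yd_act V g w))) => // h.
exact: linear_fun0 (pure_linr _).
Qed.

Definition yd_braiding_inv : tens V V -> tens V V :=
  tens_lift (fun w v =>
    \sum_(g <- finsupp (yd_dec v)) pure (yd_dec v g) (yd_act V (- g) w)).

Lemma yd_braiding_inv_linl v : linear (fun w =>
  \sum_(g <- finsupp (yd_dec v)) pure (yd_dec v g) (yd_act V (- g) w)).
Proof.
move=> a w w'; rewrite scaler_sumr -big_split /=; apply: eq_bigr => g _.
by rewrite linearP pure_linr.
Qed.

Lemma yd_braiding_inv_linr w : linear (fun v =>
  \sum_(g <- finsupp (yd_dec v)) pure (yd_dec v g) (yd_act V (- g) w)).
Proof.
apply: (yd_sum_linear (F := fun g v => pure v (yd_act V (- g) w))) => g.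
exact: pure_linl.
Qed.

Lemma yd_braiding_inv_linear : linear yd_braiding_inv.
Proof. exact: tens_lift_linear yd_braiding_inv_linl yd_braiding_inv_linr. Qed.
HB.instance Definition _ := GRing.isLinear.Build k (tens V V) (tens V V) _
  yd_braiding_inv yd_braiding_inv_linear.

Lemma yd_braiding_inv_homog g (v w : V) : yd_comp g v ->
  yd_braiding_inv (pure w v) = pure v (yd_act V (- g) w).
Proof.
move=> vg; rewrite /yd_braiding_inv.
rewrite (tens_lift_pure yd_braiding_inv_linl yd_braiding_inv_linr).
apply: (yd_sum_homog (F := fun g v => pure v (yd_act V (- g) w))) => // h.
exact: linear_fun0 (pure_linl _).
Qed.

Lemma yd_braiding_bij : bijective yd_braiding.
Proof.
exists yd_braiding_inv; elim/tens_ind => [v w||x y xE yE|a x xE].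
- elim/yd_ind: v => [g v vg|a u v uE vE]; last first.
    rewrite pure_linl !linearP.
    rewrite -[LHS]/(a *: yd_braiding_inv (yd_braiding (pure u w)) +
                    yd_braiding_inv (yd_braiding (pure v w))).
    by rewrite uE vE.
  by rewrite (yd_braiding_homog w vg) (yd_braiding_inv_homog _ vg) -yd_actD addNr yd_act0.
- by rewrite !linear0.
- transitivity (yd_braiding_inv (yd_braiding x) + yd_braiding_inv (yd_braiding y)); last by rewrite xE yE.
  by rewrite !linearD.
- transitivity (a *: yd_braiding_inv (yd_braiding x)); last by rewrite xE.
  by rewrite !linearZ.
- elim/yd_ind: w => [g w wg|a u w uE wE]; last first.
    rewrite pure_linr !linearP.
    rewrite -[LHS]/(a *: yd_braiding (yd_braiding_inv (pure v u)) +
                    yd_braiding (yd_braiding_inv (pure v w))).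
    by rewrite uE wE.
  by rewrite (yd_braiding_inv_homog _ wg) (yd_braiding_homog _ wg) -yd_actD addrN yd_act0.
- by rewrite !linear0.
- transitivity (yd_braiding (yd_braiding_inv x) + yd_braiding (yd_braiding_inv y)); last by rewrite xE yE.
  by rewrite !linearD.
- transitivity (a *: yd_braiding (yd_braiding_inv x)); last by rewrite xE.
  by rewrite !linearZ.
Qed.

Lemma yd_braid0 g (u v : V) s : yd_comp g u ->
  braid_op yd_braiding 0 (tword [:: u, v & s]) = tword [:: yd_act V g v, u & s].
Proof.
move=> ug; rewrite braid_op_word [LHS]/= -/yd_braiding (yd_braiding_homog _ ug).
by rewrite tens_talg_pure /tword !big_cons mulrA.
Qed.

Lemma yd_braid1 g (t u v : V) s : yd_comp g u ->
  braid_op yd_braiding 1 (tword [:: t, u, v & s]) =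
  tword [:: t, yd_act V g v, u & s].
Proof.
move=> ug; have := yd_braid0 v s ug; rewrite !braid_op_word => e.
by rewrite -[LHS]/(tgen t * braid_word yd_braiding 0 [:: u, v & s]) e /tword !big_cons.
Qed.

Lemma yd_braiding_eq (u v w : V) (c := fun i => braid_op yd_braiding i) :
  c 0%N (c 1%N (c 0%N (tword [:: u; v; w]))) =
  c 1%N (c 0%N (c 1%N (tword [:: u; v; w]))).
Proof.
rewrite /c; have bl i a x y : braid_op yd_braiding i (a *: x + y) =
    a *: braid_op yd_braiding i x + braid_op yd_braiding i y.
  exact: braid_op_linear.
elim/yd_ind: u => [g u ug|a u1 u2 IH1 IH2]; last first.
  by rewrite (tword_multilinear [::] [:: v; w]) !bl IH1 IH2.
elim/yd_ind: v => [h v vh|a v1 v2 IH1 IH2]; last first.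
  by rewrite (tword_multilinear [:: u] [:: w]) !bl IH1 IH2.
have gvh := yd_comp_act g vh.
rewrite (yd_braid0 _ _ ug) (yd_braid1 _ _ _ ug) (yd_braid0 _ _ gvh).
rewrite (yd_braid1 _ _ _ vh) (yd_braid0 _ _ ug) (yd_braid1 _ _ _ ug).
by rewrite -!yd_actD addrC.
Qed.

Definition yd_braided : braidedSpace k :=
  BraidedSpace yd_braiding_bij yd_braiding_eq.

End YDBraiding.

(* Main.v *)
Require Import Defs.
From HB Require Import structures.
From mathcomp Require Import all_boot all_order all_algebra finmap zify.
From mathcomp Require Import boolp classical_sets reals ereal sequences exp.
(* Imported again, so that [span] and [dim] are not those of finite-dimensional spaces. *)
Import Defs.
Import Order.TTheory GRing.Theory Num.Theory.

(** The braiding lets a homogeneous vector of degree [g] act by [g] on the vectors that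
    it jumps over.  If every degree [g] that occurs in [V] acts locally finitely on every
    component [V_h], then finitely many homogeneous vectors lie in a finite-dimensional
    graded subspace that is stable under the finitely many degrees involved and their
    inverses, because the degrees commute; such a subspace is braided
    ([stable_braided_subspace]).  This gives local finiteness
    ([torsion_locally_finite]), since every vector is a sum of homogeneous ones.

    So it has to be excluded that [V_g] contains some [x <> 0] while [g] acts on some
    [v] in [V_h] without being annihilated by a nonzero polynomial, that is, while the
    vectors [v_n = g^n v] are linearly independent ([GKdim_free]).  In that case the
    Nichols algebra has exponential growth:

    - If [g = h], then [c (v_i (x) v_j) = v_(j+1) (x) v_i].  Give a word in the [v_n] its
      total index as degree.  In the quantum symmetrizer a permutation raises the degree
      by its number of inversions, so the term of the longest permutation alone has the
      largest degree, and the words in [v_0] and [v_1] are linearly independent in the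
      Nichols algebra ([GKdim_self_free]).
    - If [g <> h], then either [h] acts freely on [v], which is the first case, or [v] can
      be replaced by an eigenvector of [h] with a free [g]-orbit ([torsion_eigenvector]).
      Then only letters [x] raise the index of letters [v].  After symmetrization of the
      words [x v_(e_1) ... x v_(e_n)] with [e_i] in [{0, 1}], the terms with the pattern
      [v x ... v x] are singled out by the grading of [V], and among these again the
      longest permutation is the only one that raises the degree as much as possible
      ([big_mixed_top]).  So these [2^n] words are linearly independent
      ([GKdim_mixed_free]).

    To pass from the tensor algebra to the Nichols algebra it is shown that the kernel of
    the quantum symmetrizer is a two-sided ideal ([qsym_ker_ideal]), hence all of the
    defining ideal: symmetrization turns left and right multiplication by a letter into
    operators that insert the letter from the left and from the right. *)

Set Implicit Arguments.
Unset Strict Implicit.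
Unset Printing Implicit Defensive.

Local Open Scope classical_set_scope.
Local Open Scope ring_scope.

(** * Spans, free families and coordinate functionals *)

Section LinearAlgebra.
Context (k : fieldType) (V : lmodType k).

Lemma span_subspace (X : set V) : subspace (span X).
Proof.
split=> [W [[]]//|a u v Xu Xv W HW]; have [[_ WL] _] := HW.
by apply: WL; [exact: Xu|exact: Xv].
Qed.

Lemma sub_span (X : set V) : X `<=` span X.
Proof. by move=> x Xx W [_]; exact. Qed.

Lemma span_min (X W : set V) : subspace W -> X `<=` W -> span X `<=` W.
Proof. by move=> sW XW x; apply. Qed.

Lemma subspaceD (W : set V) u v : subspace W -> W u -> W v -> W (u + v).
Proof. by move=> [_ WL] Wu Wv; rewrite -[u]scale1r; exact: WL. Qed.

Lemma subspaceZ (W : set V) a u : subspace W -> W u -> W (a *: u).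
Proof. by move=> [W0 WL] Wu; rewrite -[_ *: _]addr0; exact: WL. Qed.

Lemma subspace_sum (W : set V) (I : Type) (r : seq I) (P : pred I) (F : I -> V) :
  subspace W -> (forall i, P i -> W (F i)) -> W (\sum_(i <- r | P i) F i).
Proof.
move=> sW WF; elim/big_ind: _ => //; first by case: sW.
by move=> x y; exact: subspaceD.
Qed.

Lemma span_rangeP (I : finType) (e : I -> V) v :
  span (range e) v <-> exists a : I -> k, v = \sum_i a i *: e i.
Proof.
split=> [/(_ [set v | exists a : I -> k, v = \sum_i a i *: e i])|[a ->]].
  apply; split=> [|_ [i _ <-]]; first split=> [|a _ _ [b ->] [c ->]].
  - by exists (fun=> 0); rewrite big1 // => i _; rewrite scale0r.
  - exists (fun i => a * b i + c i); rewrite scaler_sumr -big_split /=.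
    by apply: eq_bigr => i _; rewrite scalerDl scalerA.
  - exists (fun j => (j == i)%:R); rewrite (bigD1 i) //= eqxx scale1r big1 ?addr0 //.
    by move=> j /negbTE ->; rewrite scale0r.
apply: subspace_sum => [|i _]; first exact: span_subspace.
by apply: (subspaceZ _ (span_subspace _)); apply: sub_span; exists i.
Qed.

Lemma lin_free_finP (I : finType) (e : I -> V) :
  lin_free e <-> forall a : I -> k, \sum_i a i *: e i = 0 -> forall i, a i = 0.
Proof.
split=> [fe a ae0 i|fe s a us ae0 i si].
  apply: (fe (index_enum I)) => //; first exact: index_enum_uniq.
have := fe (fun j => if j \in s then a j else 0).
under eq_bigr => j _ do rewrite (fun_if (fun b => b *: e j)) scale0r.
by rewrite -big_mkcond -big_uniq //= => /(_ ae0 i); rewrite si.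
Qed.

Lemma lin_free_le_span m n (b : 'I_m -> V) (e : 'I_n -> V) :
  lin_free b -> (forall i, span (range e) (b i)) -> (m <= n)%N.
Proof.
move=> /lin_free_finP fb be; have /choice[A bA] i := (span_rangeP e (b i)).1 (be i).
pose M := \matrix_(i, j) A i j; rewrite leqNgt; apply/negP => ltnm.
have : kermx M != 0.
  rewrite -mxrank_eq0 mxrank_ker subn_eq0 -ltnNge.
  exact: leq_ltn_trans (rank_leq_col M) ltnm.
case/rowV0Pn => r /sub_kermxP rM /negP; apply; apply/eqP/rowP => i; rewrite mxE.
apply: (fb (r 0)); under eq_bigr => j _ do rewrite bA scaler_sumr.
rewrite exchange_big big1 //= => j _.
under eq_bigr => l _ do rewrite scalerA; rewrite -scaler_suml.
have /(congr1 (fun N : 'rV_n => N 0 j)) := rM; rewrite !mxE => rMj.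
by under eq_bigr => l _ do rewrite -[A l j](mxE matrix_key (fun l j => A l j)); rewrite rMj scale0r.
Qed.

(** A free family of maximal size in [U] spans [U], since a vector outside its
    span could be added to it. *)
Lemma sub_span_fin_dim n (e : 'I_n -> V) (U : set V) :
  subspace U -> U `<=` span (range e) -> fin_dim U.
Proof.
move=> sU Ue.
pose P m := `[< exists b : 'I_m -> V, lin_free b /\ forall i, U (b i) >].
have Pex : exists m, P m.
  by exists 0%N; apply/asboolP; exists (fun=> 0); split=> [|[]//]; apply/lin_free_finP => a _ [].
have Pn m : P m -> (m <= n)%N.
  by move=> /asboolP[b [fb Ub]]; apply: (lin_free_le_span fb) => i; exact: (Ue _ (Ub i)).
case: (ex_maxnP Pex Pn) => m /asboolP[b [fb Ub]] mmax; exists m, b; split=> //.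
apply/seteqP; split=> [|u Uu]; first by apply: span_min => // _ [i _ <-].
apply: contrapT => nu; suff /mmax : P m.+1 by rewrite ltnn.
apply/asboolP; exists (fun i => oapp b u (unlift ord_max i)); split; last first.
  by move=> i; case: unliftP => [j|] _ /=.
apply/lin_free_finP => a; rewrite (bigD1_ord ord_max) //= unlift_none /=.
under eq_bigr => i _ do rewrite liftK /=.
have [a0|an0] := eqVneq (a ord_max) 0.
  rewrite a0 scale0r add0r => /(lin_free_finP _).1 ab0 i.
  by case: (unliftP ord_max i) => [j ->|->] //; apply: (ab0 fb).
move=> /eqP; rewrite addr_eq0 => /eqP uE; case: nu.
have -> : u = \sum_i (- (a ord_max)^-1 * a (lift ord_max i)) *: b i.
  under eq_bigr => i _ do rewrite -scalerA.
  by rewrite -scaler_sumr scaleNr -scalerN -uE scalerA mulVf ?scale1r.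
by apply/span_rangeP; exists (fun i => - (a ord_max)^-1 * a (lift ord_max i)).
Qed.

Lemma span_seq_fin_dim (s : seq V) : fin_dim (span [set` s]).
Proof.
apply: (@sub_span_fin_dim (size s) (fun i => s`_i)); first exact: span_subspace.
apply: span_min => [|x /= xs]; first exact: span_subspace.
by apply: sub_span; exists (Ordinal (etrans (index_mem x s) xs)); rewrite //= nth_index.
Qed.

Lemma dim_ge m (b : 'I_m -> V) (W : set V) :
  fin_dim W -> lin_free b -> (forall i, W (b i)) -> (m <= dim W)%N.
Proof.
move=> [n [e eW]] fb Wb; rewrite /dim.
case: xgetP => [d _ [e' [_ e'W]]|/(_ n) []]; last by exists e.
by apply: (lin_free_le_span (e := e') fb) => i; rewrite e'W.
Qed.

Definition linear_of (U : lmodType k) (f : V -> U) (fL : linear f) :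
    {linear V -> U} :=
  HB.pack_for {linear V -> U} f (GRing.isLinear.Build k V U *:%R f fL).

(** The linear combinations of a sequence of vectors, written as the image of a
    polynomial. For [e n = f^n v] this is the action of a polynomial in [f] on [v]. *)
Definition pcomb (e : nat -> V) (p : {poly k}) : V := \sum_(i < size p) p`_i *: e i.

Lemma pcombE n e (p : {poly k}) : (size p <= n)%N ->
  pcomb e p = \sum_(i < n) p`_i *: e i.
Proof.
move=> pn; rewrite /pcomb (big_ord_widen n (fun i => p`_i *: e i)) // big_mkcond /=.
by apply: eq_bigr => i _; case: ltnP => // /(nth_default 0) ->; rewrite scale0r.
Qed.

Lemma pcomb_linear e : linear (pcomb e).
Proof.
move=> a p q; pose n := maxn (size (a *: p + q)) (maxn (size p) (size q)).
rewrite !(@pcombE n) ?leq_max ?leqnn ?orbT // scaler_sumr -big_split /=.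
by apply: eq_bigr => i _; rewrite coefD coefZ scalerDl scalerA.
Qed.
HB.instance Definition _ e := GRing.isLinear.Build k {poly k} V _ (pcomb e)
  (pcomb_linear e).

Lemma lin_free_pcomb e p : lin_free e -> pcomb e p = 0 -> p = 0.
Proof.
move=> fe; rewrite /pcomb -(big_mkord xpredT (fun i => p`_i *: e i)) => pe0.
apply/polyP => i; rewrite coef0; have [ip|/(nth_default 0)//] := ltnP i (size p).
apply: (fe _ (fun i => p`_i) (iota_uniq 0 (size p - 0))) => //.
by rewrite -/(index_iota 0 (size p)) mem_index_iota.
Qed.

Lemma pcomb_lin_free e : (forall p, pcomb e p = 0 -> p = 0) -> lin_free e.
Proof.
move=> fe s a us ae0 i si.
have [n ltn] : exists n, forall j, j \in s -> (j < n)%N.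
  by exists (\max_(j <- s) j).+1 => j js; rewrite ltnS; exact: leq_bigmax_seq.
pose p := \poly_(j < n) (if j \in s then a j else 0).
have /fe/polyP/(_ i) : pcomb e p = 0.
  rewrite (@pcombE n) ?size_poly // -[RHS]ae0.
  rewrite -(big_mkord xpredT (fun j => p`_j *: e j)).
  rewrite (perm_big _ (_ : perm_eq s [seq j <- index_iota 0 n | j \in s])); last first.
    apply: uniq_perm => //; first exact/filter_uniq/iota_uniq.
    move=> j; rewrite mem_filter mem_index_iota /=.
    by case: (boolP (j \in s)) => //= /ltn ->.
  rewrite big_filter [RHS]big_mkcond; apply: eq_big_nat => j /= jn.
  by rewrite coef_poly jn; case: ifP => // _; rewrite scale0r.
by rewrite coef_poly ltn // si coef0.
Qed.

(** In a space with a countable basis the coordinates are linear functionals;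
    combining them by a right inverse of the coordinate matrix of [u] gives
    functionals dual to [u]. *)
Lemma dual_family m (u : 'I_m -> V) : countably_infinite_dim V -> lin_free u ->
  exists phi : 'I_m -> {linear V -> k^o}, forall i j, phi i (u j) = (i == j)%:R.
Proof.
move=> [e [fe eT]] fu.
have /choice[psi psiK] v : exists p, pcomb e p = v.
  have : span (range e) v by rewrite eT.
  apply: (@span_min _ [set v | exists p, pcomb e p = v]) => [|_ [i _ <-]].
    split=> [|a _ _ [p <-] [q <-]]; first by exists 0; rewrite linear0.
    by exists (a *: p + q); rewrite linearP.
  exists 'X^i; rewrite (@pcombE i.+1) ?size_polyXn // (bigD1 ord_max) //= coefXn.
  rewrite eqxx scale1r big1 ?addr0 // => j /negbTE jm.
  by rewrite coefXn (jm : (j == i :> nat) = false) scale0r.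
have psi_linear : linear psi.
  move=> a x y; apply/eqP; rewrite -subr_eq0; apply/eqP/(lin_free_pcomb fe).
  by rewrite linearB linearP /= !psiK subrr.
pose n := \max_i size (psi (u i)).
pose M : 'M[k]_(m, n) := \matrix_(i, j) (psi (u i))`_j.
have free_M : row_free M.
  rewrite -kermx_eq0; apply/eqP/row_matrixP => i; rewrite row0.
  have /(congr1 (row i)) := mulmx_ker M; rewrite row_mul row0.
  set r := row i _ => rM; apply/rowP => j; rewrite [RHS]mxE.
  move/lin_free_finP: fu => /(_ (r 0)); apply.
  under eq_bigr => l _ do rewrite -[u l]psiK (@pcombE n) ?leq_bigmax // scaler_sumr.
  rewrite exchange_big big1 //= => l _; under eq_bigr => t _ do rewrite scalerA.
  rewrite -scaler_suml; have /(congr1 (fun N : 'rV_n => N 0 l)) := rM; rewrite !mxE.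
  by under eq_bigr => t _ do rewrite [M t l]mxE; move=> ->; rewrite scale0r.
have [B MB] := row_freeP free_M.
pose phi i v : k^o := \sum_(j < n) (psi v)`_j * B j i.
have phi_linear i : linear (phi i).
  move=> a x y; rewrite /phi psi_linear scaler_sumr -big_split /=.
  by apply: eq_bigr => j _; rewrite coefD coefZ mulrDl -mulrA.
exists (fun i => linear_of (phi_linear i)).
move=> i j /=; have /(congr1 (fun N : 'M_m => N j i)) := MB; rewrite !mxE eq_sym.
by under eq_bigr => l _ do rewrite [M _ _]mxE.
Qed.

Lemma dual_seq (e : nat -> V) M :
  countably_infinite_dim V -> lin_free e ->
  exists phi : nat -> {linear V -> k^o},
    forall i j, (i < M)%N -> (j < M)%N -> phi i (e j) = (i == j)%:R.
Proof.
move=> dV fe.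
have [|phi phiE] := @dual_family M.+1 (fun i => e i) dV.
  apply/lin_free_finP => a ae0 i; have := fe _ (fun j => a (inord j)) (iota_uniq 0 (M.+1 - 0)).
  rewrite -/(index_iota 0 M.+1) big_mkord.
  under eq_bigr => j _ do rewrite inord_val.
  by move=> /(_ ae0 i); rewrite inord_val mem_index_iota /= ltn_ord; exact.
exists (fun i => phi (inord i)) => i j iM jM.
by have := phiE (inord i) (inord j); rewrite -val_eqE /= !inordK // ltnW.
Qed.

Lemma dual_vector (u : V) : countably_infinite_dim V -> u != 0 ->
  exists phi : {linear V -> k^o}, phi u = 1.
Proof.
move=> dV u0; have [|phi] := @dual_family 1 (fun=> u) dV.
  apply/lin_free_finP => a; rewrite big_ord1 => /eqP; rewrite scaler_eq0 (negbTE u0) orbF.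
  by move=> /eqP a0 i; rewrite ord1.
by move=> /(_ 0 0); exists (phi 0).
Qed.

(** In a vanishing combination, the functional of an index of largest rank among those
    with a nonzero coefficient sees only its own term. *)
Lemma lin_free_triangular (I : finType) (w : I -> V) (f : I -> {linear V -> k^o})
    (r : I -> nat) :
  (forall i, f i (w i) != 0) ->
  (forall i j, (r j <= r i)%N -> j != i -> f i (w j) = 0) -> lin_free w.
Proof.
move=> fw fw0; apply/lin_free_finP => a aw0.
apply: contrapT => /existsNP[i0 /eqP ai0].
case: (arg_maxnP r (ai0 : [pred i | a i != 0] i0)) => i /= ai rmax.
have : f i (\sum_j a j *: w j) = 0 by rewrite aw0 linear0.
rewrite linear_sum (bigD1 i) //= linearZ /= big1 => [|j ji].
  by rewrite addr0 => /eqP; rewrite mulf_eq0 (negbTE ai) (negbTE (fw i)).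
rewrite linearZ /=; have [->|aj] := eqVneq (a j) 0; first by rewrite scale0r.
by rewrite fw0 ?scaler0 //; exact: rmax.
Qed.

End LinearAlgebra.

(** * The quantum symmetrizer on words of homogeneous letters *)

Section InsertionWords.
Context (D : eqType) (act : D -> D -> D).

(** The braids [s_(j-1) ... s_0] move the leftmost letter [u] to position [j]; since
    [c (u (x) a) = (g_u a) (x) u], it acts on each letter that it jumps over. *)
Fixpoint insL (u : D) (t : seq D) : seq (seq D) :=
  if t is a :: t' then (u :: t) :: map (cons (act u a)) (insL u t')
  else [:: [:: u]].

(** The quantum symmetrizer as a formal sum of words, by the recursion
    [S_(n+1) = (sum_j s_(j-1) ... s_0) (1 (x) S_n)]. *)
Fixpoint qterms (s : seq D) : seq (seq D) :=
  if s is u :: s' then flatten [seq insL u t | t <- qterms s'] else [:: [::]].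

Lemma big_qterms_cons (U : nmodType) (F : seq D -> U) u s :
  \sum_(t <- qterms (u :: s)) F t =
  \sum_(t <- qterms s) \sum_(t' <- insL u t) F t'.
Proof. by rewrite /= big_flatten big_map. Qed.

Lemma size_insL u t t' : t' \in insL u t -> size t' = (size t).+1.
Proof.
elim: t t' => [|a t IHt] t' /=; first by rewrite inE => /eqP ->.
by rewrite inE => /predU1P[->//|/mapP[t'' /IHt tt'' ->]] /=; rewrite tt''.
Qed.

Lemma big_insL_cons (U : nmodType) (F : seq D -> U) u a t :
  \sum_(t' <- insL u (a :: t)) F t' =
  F (u :: a :: t) + \sum_(t' <- insL u t) F (act u a :: t').
Proof. by rewrite [insL _ _]/= big_cons big_map. Qed.

Lemma qterms_cons u s t' :
  reflect (exists2 t, t \in qterms s & t' \in insL u t) (t' \in qterms (u :: s)).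
Proof. exact: flatten_mapP. Qed.

Lemma size_qterms s t : t \in qterms s -> size t = size s.
Proof.
elim: s t => [|u s IHs] t; first by rewrite inE => /eqP ->.
by move=> /qterms_cons[t1 /IHs /= <-]; exact: size_insL.
Qed.

End InsertionWords.

Section QsymWords.
Context (k : fieldType) (G : zmodType) (V : ydModule k G).
Local Notation c := (yd_braiding V).

(** Letters carry their degrees, so that braiding homogeneous words becomes an
    operation on sequences. *)
Definition letter_act (u a : G * V) : G * V := (a.1, yd_act V u.1 a.2).
Definition homog (a : G * V) : Prop := yd_comp a.1 a.2.
Definition lword (t : seq (G * V)) : talg V := tword [seq a.2 | a <- t].

Definition braid_path (w : seq nat) (x : talg V) : talg V := foldr (braid_op c) x w.

Lemma braid_path_linear w : linear (braid_path w).
Proof. by move=> a x y; elim: w => //= i w ->; rewrite linearP. Qed.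
HB.instance Definition _ w := GRing.isLinear.Build k (talg V) (talg V) _
  (braid_path w) (braid_path_linear w).

Lemma braid_path_cat w1 w2 x : braid_path (w1 ++ w2) x = braid_path w1 (braid_path w2 x).
Proof. exact: foldr_cat. Qed.

Lemma tword_cons v s : tword (v :: s) = tgen v * tword s :> talg V.
Proof. exact: big_cons. Qed.

Lemma braid_op_tgen i v y : braid_op c i.+1 (tgen v * y) = tgen v * braid_op c i y.
Proof.
elim/talg_ind: y => [s|a x y IHx IHy]; last first.
  by rewrite mulrDr -scalerAr !linearP /= IHx IHy mulrDr -scalerAr.
by rewrite -tword_cons !braid_op_word.
Qed.

Lemma braid_path_tgen w v y :
  braid_path (map S w) (tgen v * y) = tgen v * braid_path w y.
Proof. by elim: w => //= i w ->; exact: braid_op_tgen. Qed.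

Lemma qsym_word_cons v s : qsym_word c (v :: s) =
  \sum_(j <- iota 0 (size s).+1) braid_path (rev (iota 0 j)) (tgen v * qsym_word c s).
Proof.
rewrite {1}/qsym_word -[reduced_words _]/[seq rev (iota 0 j) ++ map S w |
  j <- iota 0 (size s).+1, w <- reduced_words (size s)] big_allpairs_dep.
apply: eq_bigr => j _; rewrite mulr_sumr linear_sum; apply: eq_bigr => w _ /=.
by rewrite -/(braid_path _ _) braid_path_cat tword_cons braid_path_tgen.
Qed.

Lemma iotaS m n : iota m.+1 n = map S (iota m n).
Proof. by rewrite -[m.+1]add1n iotaDl. Qed.

(** Moving the leftmost letter step by step to the right realizes [insL]. *)
Lemma sum_path_insL u t : homog u ->
  \sum_(j <- iota 0 (size t).+1) braid_path (rev (iota 0 j)) (lword (u :: t)) =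
  \sum_(t' <- insL letter_act u t) lword t'.
Proof.
move=> hu; elim: t => [|a t IHt]; first by rewrite !big_seq1.
rewrite -[iota 0 _]/(0%N :: iota 1 (size t).+1) [insL _ _ _]/=
  big_cons [RHS]big_cons iotaS !big_map.
congr (_ + _).
under [RHS]eq_bigr => t' _ do rewrite [lword _]tword_cons.
rewrite -mulr_sumr -IHt mulr_sumr; apply: eq_bigr => j _.
rewrite -braid_path_tgen -[iota 0 j.+1]/(0%N :: iota 1 j) rev_cons -cats1.
rewrite braid_path_cat iotaS map_rev; congr (braid_path _ _).
exact: etrans (yd_braid0 _ _ hu) (tword_cons _ _).
Qed.

Definition left_insertion_word v s : talg V :=
  \sum_(j <- iota 0 (size s).+1) braid_path (rev (iota 0 j)) (tword (v :: s)).

Lemma left_insertion_multilinear v : multilinear (left_insertion_word v).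
Proof.
move=> s1 s2 a x y; rewrite /left_insertion_word !size_cat /=.
rewrite scaler_sumr -big_split /=; apply: eq_bigr => j _.
by rewrite (tword_multilinear (v :: s1)) linearP.
Qed.

Definition left_insertion v : {linear talg V -> talg V} :=
  linear_of (talg_lift_linear (left_insertion_multilinear v)).

Lemma left_insertionE u t : homog u ->
  left_insertion u.2 (lword t) = \sum_(t' <- insL letter_act u t) lword t'.
Proof.
move=> hu; rewrite /= talg_lift_word; last exact: left_insertion_multilinear.
by rewrite -sum_path_insL // /left_insertion_word size_map.
Qed.

Lemma homog_act u a : homog a -> homog (letter_act u a).
Proof. exact: yd_comp_act. Qed.

Definition homog_word (s : seq (G * V)) : Prop := forall a, a \in s -> homog a.

Lemma homog_word_cons a s : homog_word (a :: s) <-> homog a /\ homog_word s.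
Proof.
split=> [hs|[ha hs] b]; last by rewrite inE => /predU1P[->|/hs].
by split=> [|b bs]; apply: hs; rewrite inE ?eqxx ?bs ?orbT.
Qed.

Lemma homog_insL u t t' : homog u -> homog_word t ->
  t' \in insL letter_act u t -> homog_word t'.
Proof.
move=> hu; elim: t t' => [|a t IHt] t' /=; first by rewrite inE => _ /eqP ->; exact/homog_word_cons.
move=> hat; have [ha ht] := (homog_word_cons _ _).1 hat.
rewrite inE => /predU1P[->|/mapP[t1 /(IHt _ ht) ht1 ->]]; first exact/homog_word_cons.
by apply/homog_word_cons; split=> //; exact: homog_act.
Qed.

Lemma homog_qterms s t : homog_word s -> t \in qterms letter_act s -> homog_word t.
Proof.
elim: s t => [|u s IHs] t; first by rewrite inE => _ /eqP ->.
move=> /homog_word_cons[hu hs] /qterms_cons[t1 /(IHs _ hs)]; exact: homog_insL.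
Qed.

Lemma lword_cons a s : lword (a :: s) = tgen a.2 * lword s.
Proof. exact: tword_cons. Qed.

Lemma qsym_lword s : homog_word s ->
  qsym c (lword s) = \sum_(t <- qterms letter_act s) lword t.
Proof.
rewrite qsym_wordE; elim: s => [|u s IHs].
  by move=> _; rewrite /qsym_word !big_seq1.
move=> /homog_word_cons[hu hs]; rewrite [map _ _]/= qsym_word_cons IHs // size_map.
rewrite big_qterms_cons mulr_sumr.
under eq_bigr => j _ do rewrite linear_sum /=.
rewrite exchange_big /= !big_seq; apply: eq_bigr => t st.
by rewrite -sum_path_insL // -(size_qterms st); apply: eq_bigr => j _; rewrite lword_cons.
Qed.

Lemma talg_homog_ind (P : talg V -> Prop) :
  (forall s, homog_word s -> P (lword s)) ->
  (forall a x y, P x -> P y -> P (a *: x + y)) -> forall x, P x.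
Proof.
move=> Pw PL; elim/talg_ind => // s; rewrite -[s]cat0s.
have : homog_word [::] by [].
rewrite -[X in X ++ s]/(map snd ([::] : seq (G * V))).
elim: s [::] => [|v s IHs] s1 hs1; first by rewrite cats0; exact: Pw.
elim/yd_ind: v => [g v vg|a u v IHu IHv]; last by rewrite tword_multilinear; exact: PL.
rewrite -cat_rcons -[v]/((g, v).2) -map_rcons; apply: IHs => b.
by rewrite mem_rcons inE => /predU1P[->|/hs1].
Qed.

Lemma qsym_homog_mull u x : homog u ->
  qsym c (tgen u.2 * x) = left_insertion u.2 (qsym c x).
Proof.
move=> hu; elim/talg_homog_ind: x => [s hs|a x y IHx IHy]; last first.
  rewrite mulrDr -scalerAr [LHS]linearP [qsym c (_ + _)]linearP [RHS]linearP.
  by congr (_ *: _ + _).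
rewrite -lword_cons !qsym_lword //; last exact/homog_word_cons.
by rewrite big_qterms_cons linear_sum; apply: eq_bigr => t _; rewrite left_insertionE.
Qed.

(** The mirror image of [insL]: the rightmost letter moves to the left, and is acted on
    by each letter that it jumps over. *)
Fixpoint insR (v : G * V) (t : seq (G * V)) : seq (seq (G * V)) :=
  if t is a :: t' then
    (foldr letter_act v t :: t) :: map (cons a) (insR v t')
  else [:: [:: v]].

Lemma foldr_letter_act v t :
  foldr letter_act v t = (v.1, yd_act V (\sum_(a <- t) a.1) v.2).
Proof.
elim: t => [|a t IHt] /=; first by rewrite big_nil yd_act0; case: v.
by rewrite IHt big_cons yd_actD.
Qed.

Lemma degree_insL u t t' : t' \in insL letter_act u t ->
  \sum_(a <- t') a.1 = u.1 + \sum_(a <- t) a.1.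
Proof.
elim: t t' => [|a t IHt] t' /=; first by rewrite inE => /eqP ->; rewrite big_cons.
rewrite inE => /predU1P[->|/mapP[t1 /IHt tE ->]]; first by rewrite big_cons.
by rewrite !big_cons tE addrCA.
Qed.

Lemma big_insR_cons (U : nmodType) (F : seq (G * V) -> U) v a t :
  \sum_(t' <- insR v (a :: t)) F t' =
  F (foldr letter_act v (a :: t) :: a :: t) + \sum_(t' <- insR v t) F (a :: t').
Proof. by rewrite [insR _ _]/= big_cons big_map. Qed.

(** The actions of different degrees commute, and acting on a letter does not change its
    degree, so the two insertions do not interfere. *)
Lemma insL_insR (U : nmodType) (F : seq (G * V) -> U) u v t :
  \sum_(t1 <- insR v t) \sum_(t2 <- insL letter_act u t1) F t2 =
  \sum_(t1 <- insL letter_act u t) \sum_(t2 <- insR v t1) F t2.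
Proof.
elim: t F => [|a t IHt] F.
  by rewrite !big_seq1 !big_cons !big_nil /= !addr0 addrC.
rewrite big_insR_cons big_insL_cons [RHS]big_insL_cons big_insR_cons.
rewrite big_insL_cons big_insR_cons [letter_act u (foldr _ _ _)]/=.
under [X in _ + X = _]eq_bigr => t1 _ do rewrite big_insL_cons.
under [X in _ = _ + X]eq_bigr => t1 _ do rewrite big_insR_cons.
rewrite !big_split /= IHt !addrA; congr (_ + _).
rewrite [LHS]addrAC; congr (_ + _); first by congr (_ + _); rewrite addrC.
rewrite !big_seq; apply: eq_bigr => t1 /degree_insL t1E.
congr (F (_ :: _)); rewrite !foldr_letter_act /letter_act /= t1E.
by rewrite -!yd_actD !addrA (addrC u.1).
Qed.

Lemma path_rcons v t : homog_word t ->
  braid_path (iota 0 (size t)) (lword (rcons t v)) = lword (foldr letter_act v t :: t).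
Proof.
elim: t => //= a t IHt /homog_word_cons[ha ht].
by rewrite lword_cons iotaS braid_path_tgen IHt // -lword_cons [LHS](yd_braid0 _ _ ha).
Qed.

(** Moving the rightmost letter step by step to the left realizes [insR]. *)
Lemma sum_path_insR v t : homog_word t ->
  \sum_(j <- iota 0 (size t).+1)
     braid_path (iota j (size t - j)) (lword (rcons t v)) =
  \sum_(t' <- insR v t) lword t'.
Proof.
elim: t => [|a t IHt]; first by rewrite !big_seq1.
move=> hat; have [_ ht] := (homog_word_cons _ _).1 hat; rewrite big_insR_cons.
rewrite -[iota 0 _]/(0%N :: iota 1 (size t).+1) big_cons iotaS big_map.
congr (_ + _); first by rewrite subn0 path_rcons.
under [RHS]eq_bigr => t' _ do rewrite lword_cons.
rewrite -mulr_sumr -IHt // mulr_sumr; apply: eq_bigr => j _.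
by rewrite iotaS subSS lword_cons braid_path_tgen.
Qed.

Definition right_insertion_word v s : talg V :=
  \sum_(j <- iota 0 (size s).+1) braid_path (iota j (size s - j)) (tword (rcons s v)).

Lemma right_insertion_multilinear v : multilinear (right_insertion_word v).
Proof.
move=> s1 s2 a x y; rewrite /right_insertion_word !size_cat /=.
rewrite scaler_sumr -big_split /=; apply: eq_bigr => j _.
by rewrite !rcons_cat !rcons_cons tword_multilinear linearP.
Qed.

Definition right_insertion v : {linear talg V -> talg V} :=
  linear_of (talg_lift_linear (right_insertion_multilinear v)).

Lemma right_insertionE v t : homog_word t ->
  right_insertion v.2 (lword t) = \sum_(t' <- insR v t) lword t'.
Proof.
move=> ht; rewrite /= talg_lift_word; last exact: right_insertion_multilinear.
by rewrite -sum_path_insR // /right_insertion_word size_map -map_rcons.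
Qed.

Lemma big_qterms_rcons (U : nmodType) (F : seq (G * V) -> U) s v :
  \sum_(t <- qterms letter_act (rcons s v)) F t =
  \sum_(t <- qterms letter_act s) \sum_(t' <- insR v t) F t'.
Proof.
elim: s F => [|u s IHs] F; first by rewrite !big_seq1.
by rewrite rcons_cons !big_qterms_cons IHs; apply: eq_bigr => t _; exact: insL_insR.
Qed.

Lemma lword_rcons s v : lword (rcons s v) = lword s * tgen v.2.
Proof. by rewrite /lword map_rcons /tword -cats1 big_cat big_seq1. Qed.

Lemma qsym_homog_mulr v x : homog v ->
  qsym c (x * tgen v.2) = right_insertion v.2 (qsym c x).
Proof.
move=> hv; elim/talg_homog_ind: x => [s hs|a x y IHx IHy]; last first.
  rewrite mulrDl -scalerAl [LHS]linearP [qsym c (_ + _)]linearP [RHS]linearP.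
  by congr (_ *: _ + _).
have hsv : homog_word (rcons s v).
  by move=> b; rewrite mem_rcons inE => /predU1P[->|/hs].
rewrite -lword_rcons !qsym_lword // big_qterms_rcons linear_sum !big_seq.
by apply: eq_bigr => t st; rewrite right_insertionE //; exact: homog_qterms st.
Qed.

(** After symmetrization, left and right multiplication by a letter become the insertion
    operators. *)
Lemma qsym_ker_ideal : two_sided_ideal [set x | qsym c x = 0].
Proof.
split; first split=> [|a x y /= x0 y0]; rewrite /= ?linear0 //.
  by rewrite linearP /= x0 y0 scaler0 addr0.
have genl v y : qsym c y = 0 -> qsym c (tgen v * y) = 0.
  move=> y0; elim/yd_ind: v => [g v vg|a u v IHu IHv].
    by have := @qsym_homog_mull (g, v) y vg; rewrite y0 linear0.
  by rewrite linearP mulrDl -scalerAl linearP /= IHu IHv scaler0 addr0.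
have genr v y : qsym c y = 0 -> qsym c (y * tgen v) = 0.
  move=> y0; elim/yd_ind: v => [g v vg|a u v IHu IHv].
    by have := @qsym_homog_mulr (g, v) y vg; rewrite y0 linear0.
  by rewrite linearP mulrDr -scalerAr linearP /= IHu IHv scaler0 addr0.
move=> x y /= y0; split; elim/talg_ind: x => [s|a x1 x2 IH1 IH2].
- elim: s => [|v s IHs]; first by rewrite /tword big_nil mul1r.
  by rewrite tword_cons -mulrA; exact: genl.
- by rewrite mulrDl -scalerAl linearP /= IH1 IH2 scaler0 addr0.
- elim/last_ind: s => [|s v IHs]; first by rewrite /tword big_nil mulr1.
  by rewrite /tword -cats1 big_cat big_seq1 mulrA; exact: genr.
- by rewrite mulrDr -scalerAr linearP /= IH1 IH2 scaler0 addr0.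
Qed.

Lemma quot_pi_nichols_eq0 (x : talg V) :
  @quot_pi _ _ (nichols_proper_ideal (yd_braided V)) x = 0 -> qsym c x = 0.
Proof.
rewrite -[0](linear0 (@quot_pi _ _ _)) => /quot_piP; rewrite subr0.
by move=> /(_ [set y | qsym c y = 0]); apply; split; [exact: qsym_ker_ideal|].
Qed.

End QsymWords.

(** * Exponential growth forces infinite Gelfand-Kirillov dimension *)

Lemma limn_esup_pinfty (R : realType) (u : nat -> \bar R) :
  (forall M n, exists2 i, (n <= i)%N & (M%:R%:E <= u i)%E) -> limn_esup u = +oo%E.
Proof.
move=> uM; rewrite limn_esup_lim; apply/cvg_lim => //.
suff <- : ereal_inf (range (esups u)) = +oo%E by exact: cvg_esups_inf.
apply/ereal_inf_pinfty => _ [n _ <-]; apply/eqyP => x x0.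
have [i ni uMi] := uM (Num.truncn x).+1 n.
have xM : (x%:E <= (Num.truncn x).+1%:R%:E)%E.
  by rewrite lee_fin ltW // -truncn_lt_nat ?ltW.
apply: le_trans xM _; apply: le_trans uMi _.
by apply: ereal_sup_ubound; exists i.
Qed.

Section Growth.
Context (R : realType) (k : fieldType) (A : algType k).

Fixpoint word_products (L : seq A) (n : nat) : seq A :=
  if n is n'.+1 then
    word_products L n' ++ [seq x * y | x <- L, y <- word_products L n']
  else [:: 1].

Lemma pow_le_fin_dim (L : seq A) n : fin_dim (pow_le (span [set` L]) n).
Proof.
have [m [e [_ eS]]] := span_seq_fin_dim (word_products L n).
apply: (@sub_span_fin_dim _ _ m e); first exact: span_subspace.
rewrite eS {m e eS}; apply: span_min => [|_ [s [sn sL ->]]]; first exact: span_subspace.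
elim: n s sn sL => [|n IHn] [|y s] //= sn sL.
- by rewrite big_nil; apply: sub_span; rewrite /= inE.
- rewrite big_nil; have IH1 : span [set` word_products L n] 1.
    by have := IHn [::] isT; rewrite big_nil; apply.
  apply: (span_min (span_subspace _) _ IH1) => x /= xn.
  by apply: sub_span; rewrite /= mem_cat xn.
have yL : span [set` L] y by apply: sL; rewrite inE eqxx.
have zn : span [set` word_products L n] (\prod_(z <- s) z).
  by apply: IHn => // z zs; apply: sL; rewrite inE zs orbT.
rewrite big_cons; move: (\prod_(z <- s) z) zn => z zn.
set S := span _; have sS : subspace S by exact: span_subspace.
suff : [set y | S (y * z)] y by [].
apply: (span_min _ _ yL) => [|x /= xL].
  split=> [|a x1 x2 /= H1 H2]; rewrite /= ?mul0r; first by case: sS.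
  by rewrite mulrDl -scalerAl; apply: sS.2.
suff : [set z | S (x * z)] z by [].
apply: (span_min _ _ zn) => [|t /= tn].
  split=> [|a x1 x2 /= H1 H2]; rewrite /= ?mulr0; first by case: sS.
  by rewrite mulrDr -scalerAr; apply: sS.2.
apply: sub_span; rewrite /= mem_cat; apply/orP; right.
by apply/allpairsP; exists (x, t).
Qed.

Lemma dim_ge_card (I : finType) (w : I -> A) (W : set A) :
  fin_dim W -> lin_free w -> (forall i, W (w i)) -> (#|I| <= dim W)%N.
Proof.
move=> fW fw Ww; apply: (@dim_ge _ _ _ (fun i : 'I_#|I| => w (enum_val i))) => //.
apply/lin_free_finP => a aw0 i; rewrite -[i]enum_valK.
apply: ((lin_free_finP w).1 fw (fun i => a (enum_rank i))).
rewrite (reindex (@enum_val I predT)) /=; last exact/onW_bij/enum_val_bij.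
by under eq_bigr => j _ do rewrite enum_valK.
Qed.

(** The dimension of the products of length [2 ^ (2 q + 1)] is at least
    [2 ^ (4 ^ q)], and [4 ^ q / (2 q + 1)] is unbounded. *)
Lemma GKdim_exponential (L : seq A) :
  (forall m, exists w : m.-tuple bool -> A, lin_free w /\
     forall i, exists s : seq A, [/\ (size s <= m.*2)%N, {subset s <= L}
                                   & w i = \prod_(x <- s) x]) ->
  GKdim R A = +oo%E.
Proof.
move=> Lw; pose W := span [set` L].
have dimW m : (2 ^ m <= dim (pow_le W m.*2))%N.
  have [w [fw ws]] := Lw m.
  have := @dim_ge_card _ w _ (pow_le_fin_dim L m.*2) fw; rewrite card_tuple card_bool.
  apply=> i; have [s [sm sL ->]] := ws i; apply: sub_span; exists s; split=> // y ys.
  by apply: sub_span => /=; exact: sL.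
apply/eqP; rewrite -leye_eq.
suff <- : limn_esup (fun n => (ln (dim (pow_le W n))%:R / ln n%:R)%:E) = +oo%E :> \bar R.
  by apply: ereal_sup_ubound; exists W => //; exact: span_seq_fin_dim.
apply: limn_esup_pinfty => M n; pose q := (M.*2 + n)%N.
have Mq : (M * q.*2.+1 <= 2 ^ q.*2)%N.
  rewrite -addnn expnD; have := ltn_expl q (ltnSn 1); rewrite /q; nia.
exists (2 ^ q.*2.+1)%N.
  by apply: leq_trans (ltnW (ltn_expl _ (ltnSn 1))); rewrite /q; lia.
rewrite lee_fin ler_pdivlMr; last by rewrite ln_gt0 // ltr1n -{1}(expn0 2) ltn_exp2l.
have := dimW (2 ^ q.*2)%N; rewrite -[(2 ^ q.*2).*2]mul2n -expnS => dimWq.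
have lnX m : ln (2 ^ m)%:R = m%:R * ln 2 :> R by rewrite natrX lnXn // mulr_natl.
apply: (@le_trans _ _ (ln (2 ^ 2 ^ q.*2)%:R)); last first.
  by rewrite ler_ln ?posrE ?ltr0n ?ler_nat ?expn_gt0 // (leq_trans _ dimWq) ?expn_gt0.
rewrite !lnX mulrA -natrM ler_wpM2r ?ler_nat //.
by rewrite ln_ge0 // ler1n.
Qed.

End Growth.

(** * Leading terms of symmetrized words *)

Section TensorForms.
Context (k : fieldType) (V : lmodType k).

(** The value on a word of the tensor product of a sequence of functionals. *)
Fixpoint tens_form (phi : seq {linear V -> k^o}) (s : seq V) : k^o :=
  match phi, s with
  | [::], [::] => 1
  | f :: phi', v :: s' => f v * tens_form phi' s'
  | _, _ => 0
  end.

Lemma tens_form_multilinear phi : multilinear (tens_form phi).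
Proof.
elim: phi => [|f phi IHphi] [|x s1] s2 a u v /=; rewrite ?scaler0 ?addr0 //.
  by rewrite linearP /= mulrDl -scalerAl.
by rewrite IHphi mulrDr -scalerAr.
Qed.

Definition talg_form phi : {linear talg V -> k^o} :=
  linear_of (talg_lift_linear (tens_form_multilinear phi)).

Lemma talg_form_word phi s : talg_form phi (tword s) = tens_form phi s.
Proof. exact: talg_lift_word (tens_form_multilinear phi) s. Qed.

Lemma tens_form_neq0 (D : eqType) (K : eqType) (key : D -> K)
    (vec : D -> V) (phi : D -> {linear V -> k^o}) (t1 t2 : seq D) :
  (forall a b, a \in t1 -> b \in t2 -> phi a (vec b) != 0 -> key a = key b) ->
  tens_form (map phi t1) (map vec t2) != 0 -> map key t1 = map key t2.
Proof.
elim: t1 t2 => [|a t1 IHt] [|b t2] //= H; rewrite ?eqxx // mulf_eq0 negb_or.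
move=> /andP[/H -> //]; rewrite ?inE ?eqxx // => /IHt -> // a' b' a't b't.
by apply: H; rewrite inE ?a't ?b't orbT.
Qed.

Lemma tens_form_self (D : eqType) (vec : D -> V) (phi : D -> {linear V -> k^o})
    (t : seq D) :
  (forall a, a \in t -> phi a (vec a) != 0) -> tens_form (map phi t) (map vec t) != 0.
Proof.
elim: t => [|a t IHt] H /=; first exact: oner_neq0.
rewrite mulf_neq0 ?H ?inE ?eqxx // IHt // => b bt.
by apply: H; rewrite inE bt orbT.
Qed.

End TensorForms.

Section LeadingTerms.
Context (D : eqType) (act : D -> D -> D).
Local Notation insL := (insL act).

Lemma map_qterms (D' : eqType) (act' : D' -> D' -> D') (f : D -> D') s :
  (forall u a, f (act u a) = act' (f u) (f a)) ->
  qterms act' (map f s) = map (map f) (qterms act s).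
Proof.
move=> fact; elim: s => //= u s ->; rewrite map_flatten -!map_comp.
congr flatten; apply: eq_map => t /=.
by elim: t => //= a t ->; rewrite -!map_comp; congr (_ :: _); apply: eq_map => t' /=; rewrite fact.
Qed.

(** The insertion at the last position contributes the leading terms; these are the
    other ones. *)
Fixpoint insI (u : D) (t : seq D) : seq (seq D) :=
  if t is a :: t' then (u :: t) :: map (cons (act u a)) (insI u t') else [::].

Lemma insLE u t : insL u t = rcons (insI u t) (rcons (map (act u) t) u).
Proof. by elim: t => //= a t ->; rewrite map_rcons. Qed.

End LeadingTerms.

Section NicholsGrowth.
Context (R : realType) (k : fieldType) (G : zmodType) (V : ydModule k G).
Local Notation c := (yd_braiding V).
Local Notation B := (nichols (yd_braided V)).
Local Notation q := (@quot_pi _ _ (nichols_proper_ideal (yd_braided V))).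

Lemma nichols_GKdim_exponential (L : seq V) (w : seq bool -> seq V) :
  (forall b, (size (w b) <= (size b).*2)%N /\ {subset w b <= L}) ->
  (forall m, lin_free (fun b : m.-tuple bool => qsym c (tword (w b)))) ->
  GKdim R B = +oo%E.
Proof.
move=> wL wfree.
apply: (@GKdim_exponential _ _ _ [seq q (tgen v) | v <- L]) => m.
exists (fun b : m.-tuple bool => q (tword (w b))); split=> [|b]; last first.
  have [sw wLb] := wL b; exists [seq q (tgen v) | v <- w b]; split.
  - by rewrite size_map (leq_trans sw) // size_tuple.
  - by move=> _ /mapP[v /wLb vL ->]; exact: map_f.
  - by rewrite big_map /tword rmorph_prod.
apply/lin_free_finP => a aw0; apply: ((lin_free_finP _).1 (wfree m)).
have : q (\sum_b a b *: tword (w b)) = 0.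
  by rewrite linear_sum -[RHS]aw0; apply: eq_bigr => b _; rewrite linearZ.
move=> /quot_pi_nichols_eq0 qs0; rewrite -[RHS]qs0 linear_sum.
by apply: eq_bigr => b _; rewrite linearZ.
Qed.

(** Products of functionals that detect [key] single out the leading term [top b]; on the
    symmetrization of another word [src b'] whose leading term has at most the same
    degree [dg] they vanish, so the functionals form a triangular system. *)
Lemma leading_term_free (D K : eqType) (act : D -> D -> D) (f : D -> G * V)
    (key : D -> K) (good : pred (seq D)) (dg : seq D -> nat) m
    (src top : seq bool -> seq D) (phi : D -> {linear V -> k^o}) :
  (forall u a, f (act u a) = letter_act (f u) (f a)) ->
  (forall a, homog (f a)) ->
  (forall t1 t2, map key t1 = map key t2 -> good t1 = good t2 /\ dg t1 = dg t2) ->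
  (forall b, size b = m -> good (top b)) ->
  (forall b1 b2, size b1 = m -> size b2 = m ->
     map key (top b1) = map key (top b2) -> b1 = b2) ->
  (forall b t, size b = m -> t \in qterms act (src b) -> (dg t <= dg (top b))%N) ->
  (forall b (F : seq D -> k^o), size b = m ->
     \sum_(t <- qterms act (src b) | good t && (dg t == dg (top b))) F t = F (top b)) ->
  (forall b b' t a a', size b = m -> size b' = m -> t \in qterms act (src b') ->
     a \in top b -> a' \in t -> phi a (f a').2 != 0 -> key a = key a') ->
  (forall b a, size b = m -> a \in top b -> phi a (f a).2 != 0) ->
  lin_free (fun b : m.-tuple bool => qsym c (lword (map f (src b)))).
Proof.
move=> fact homf keyP goodtop topinj dgle sumtop phikey phitop.
pose Phi b := talg_form (map phi (top b)).
have PhiE b b' : size b = m -> size b' = m -> (dg (top b') <= dg (top b))%N ->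
    Phi b (qsym c (lword (map f (src b')))) =
    if dg (top b') == dg (top b) then
      tens_form (map phi (top b)) [seq (f a).2 | a <- top b'] else 0.
  move=> bm b'm le_dg; rewrite qsym_lword; last by move=> _ /mapP[a _ ->].
  rewrite (map_qterms _ fact) big_map linear_sum.
  rewrite (eq_bigr (fun t => tens_form (map phi (top b)) [seq (f a).2 | a <- t])); last first.
    by move=> t _; rewrite [LHS]talg_form_word -map_comp.
  have F0 t : t \in qterms act (src b') ->
      tens_form (map phi (top b)) [seq (f a).2 | a <- t] != 0 ->
      good t && (dg t == dg (top b)).
    move=> tb' tn0; have /keyP[<- <-] : map key (top b) = map key t.
      by apply: tens_form_neq0 tn0 => a a' atop a't; exact: phikey bm b'm tb' atop a't.
    by rewrite goodtop // eqxx.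
  case: eqP => [dgE|/eqP dgN].
    rewrite -(sumtop _ (fun t => tens_form _ [seq (f a).2 | a <- t])) //.
    rewrite [RHS]big_mkcond !big_seq; apply: eq_bigr => t tb'.
    by case: ifPn => //; rewrite dgE; apply: contraNeq => /(F0 _ tb').
  rewrite big_seq big1 // => t tb'; apply/eqP; apply: contraTT (dgle _ _ b'm tb').
  by move=> /(F0 _ tb') /andP[_ /eqP ->]; rewrite -ltnNge ltn_neqAle dgN.
apply: (lin_free_triangular (I := m.-tuple bool : finType) (f := fun b => Phi b)
  (r := fun b => dg (top b))) => [b|b b' le_dg bb'].
  by rewrite PhiE ?size_tuple ?eqxx // tens_form_self // => a; exact/phitop/size_tuple.
rewrite PhiE ?size_tuple //; case: eqP => // _; apply/eqP; apply: contraNT bb' => tn0.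
have bm := size_tuple b; have b'm := size_tuple b'.
have topb' : top b' \in qterms act (src b').
  apply: contraT => ntop; have := sumtop b' (fun t => (t == top b')%:R) b'm.
  rewrite eqxx big_seq_cond big1 => [/esym/eqP|t /andP[tb' _]]; first by rewrite oner_eq0.
  by case: eqP tb' => // ->; rewrite (negbTE ntop).
apply/eqP/val_inj/esym/topinj => //; apply: tens_form_neq0 tn0 => a a' atop a'top.
exact: phikey bm b'm topb' atop a'top.
Qed.

End NicholsGrowth.

(** * A degree acting freely on its own component *)

Section SelfAction.

(** The letter [a] stands for [g^a v], where [v] has degree [g]. *)
Definition self_act (u a : nat) : nat := a.+1.

(** The contribution of the longest permutation, which has the largest degree. *)
Fixpoint self_top (s : seq nat) : seq nat :=
  if s is u :: s' then rcons (map S (self_top s')) u else [::].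

Lemma sumn_map_succ t : sumn (map S t) = (sumn t + size t)%N.
Proof. by elim: t => //= a t ->; rewrite addSn addnS addnA. Qed.

Lemma size_self_top s : size (self_top s) = size s.
Proof. by elim: s => //= u s IHs; rewrite size_rcons size_map IHs. Qed.

Lemma sumn_self_top u s :
  sumn (self_top (u :: s)) = (u + sumn (self_top s) + size s)%N.
Proof. by rewrite /= sumn_rcons sumn_map_succ size_self_top; lia. Qed.

Lemma sumn_insI u t t' : t' \in insI self_act u t -> (sumn t' < u + sumn t + size t)%N.
Proof.
elim: t t' => //= a t IHt t'; rewrite inE.
by move=> /predU1P[->|/mapP[t1 /IHt ? ->]]; rewrite /= /self_act; lia.
Qed.

Lemma sumn_insL u t t' : t' \in insL self_act u t -> (sumn t' <= u + sumn t + size t)%N.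
Proof.
rewrite insLE mem_rcons inE => /predU1P[->|/sumn_insI/ltnW//].
by rewrite sumn_rcons [sumn _]sumn_map_succ addnC addnA.
Qed.

Lemma sumn_qterms s t : t \in qterms self_act s -> (sumn t <= sumn (self_top s))%N.
Proof.
elim: s t => [|u s IHs] t; first by rewrite inE => /eqP ->.
case/qterms_cons=> t0 st0 /sumn_insL/leq_trans -> //.
by rewrite sumn_self_top (size_qterms st0) leq_add2r leq_add2l IHs.
Qed.

(** An insertion before the last position jumps over fewer letters and thus raises the
    degree by less. *)
Lemma big_self_top (U : nmodType) (F : seq nat -> U) s :
  \sum_(t <- qterms self_act s | sumn t == sumn (self_top s)) F t = F (self_top s).
Proof.
elim: s F => [|u s IHs] F; first by rewrite big_mkcond big_seq1.
rewrite big_mkcond big_qterms_cons /= -(IHs (fun t => F (rcons (map S t) u))).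
rewrite [RHS]big_mkcond !big_seq; apply: eq_bigr => t st.
rewrite insLE -cats1 big_cat big_seq1 /= -[sumn (rcons _ _)]/(sumn (self_top (u :: s))).
rewrite sumn_self_top -(size_qterms st) big_seq big1 ?add0r => [|t' /sumn_insI].
  rewrite sumn_rcons sumn_map_succ; congr (if _ then _ else _).
  by rewrite addnC addnA eqn_add2r eqn_add2l.
by move: (sumn_qterms st); case: eqP => // ->; lia.
Qed.

Lemma self_top_inj : injective self_top.
Proof.
elim=> [|u s IHs] [|u' s'] //= /(congr1 (@rev nat)); rewrite ?rev_rcons //.
by move=> [-> /(can_inj revK)/(inj_map succn_inj)/IHs ->].
Qed.

Lemma sumn_self_top_le (b : seq bool) :
  (sumn (self_top (map nat_of_bool b)) <= size b + size b * size b)%N.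
Proof.
elim: b => // e b IHb; rewrite [map _ _]/= sumn_self_top size_map /=.
by case: e; lia.
Qed.

Lemma leq_sumn (t : seq nat) a : a \in t -> (a <= sumn t)%N.
Proof. by elim: t => //= b t IHt; rewrite inE => /predU1P[->|/IHt]; lia. Qed.

Lemma GKdim_self_free (R : realType) (k : fieldType) (G : zmodType) (V : ydModule k G)
    (g : G) (v : V) :
  countably_infinite_dim V -> yd_comp g v ->
  lin_free (fun n : nat => yd_act V (g *+ n) v) ->
  GKdim R (nichols (yd_braided V)) = +oo%E.
Proof.
move=> dV vg fv; pose f n := (g, yd_act V (g *+ n) v).
apply: (@nichols_GKdim_exponential _ _ _ _ [:: v; yd_act V g v]
  (fun b => [seq (f (nat_of_bool e)).2 | e <- b])) => [b|m].
  split=> [|x /mapP[e _ ->]]; first by rewrite size_map -addnn leq_addl.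
  by case: e; rewrite !inE /= ?mulr0n ?mulr1n ?yd_act0 eqxx ?orbT.
have -> : (fun b : m.-tuple bool =>
      qsym (yd_braiding V) (tword [seq (f (nat_of_bool e)).2 | e <- b])) =
    (fun b => qsym (yd_braiding V) (lword (map f (map nat_of_bool b)))).
  by apply/funext => b; rewrite /lword -!map_comp.
have [phi phiE] := dual_seq (m + m * m).+1 dV fv.
have letter_lt b t a : size b = m -> t \in qterms self_act (map nat_of_bool b) ->
    a \in t -> (a < (m + m * m).+1)%N.
  move=> bm /sumn_qterms tb /leq_sumn at_; rewrite ltnS (leq_trans at_) // (leq_trans tb) //.
  by rewrite -bm sumn_self_top_le.
have top_lt b a : size b = m -> a \in self_top (map nat_of_bool b) ->
    (a < (m + m * m).+1)%N.
  by move=> bm /leq_sumn at_; rewrite ltnS (leq_trans at_) // -bm sumn_self_top_le.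
apply: (@leading_term_free _ _ _ _ _ self_act f id xpredT sumn m
  (map nat_of_bool) (fun b => self_top (map nat_of_bool b)) phi) => //.
- by move=> u a; rewrite /letter_act /f /= mulrS yd_actD.
- by move=> a; exact: yd_comp_act.
- by move=> t1 t2; rewrite !map_id => ->.
- move=> b1 b2 _ _; rewrite !map_id => /self_top_inj.
  by apply: inj_map => -[] [].
- by move=> b t _; exact: sumn_qterms.
- by move=> b F _; exact: big_self_top.
- move=> b b' t a a' bm b'm tb atop a't.
  rewrite (phiE _ _ (top_lt _ _ bm atop) (letter_lt _ _ _ b'm tb a't)).
  by case: (eqVneq a a') => // _; rewrite mulr0n eqxx.
- move=> b a bm atop; have aM := top_lt _ _ bm atop.
  by rewrite phiE // eqxx oner_eq0.
Qed.

End SelfAction.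

(** * A degree acting freely on another component *)

Section MixedAction.

(** The letter [(b, (i, j))] stands for [g^i h^j x] if [b] holds and for [g^i h^j v]
    otherwise, where [x] has degree [g] and [v] has degree [h]. *)
Local Notation letter := (bool * (nat * nat))%type.

Definition pass_x (a : letter) : letter := (a.1, (a.2.1.+1, a.2.2)).
Definition pass_v (a : letter) : letter := (a.1, (a.2.1, a.2.2.+1)).
Definition mixed_act (u : letter) : letter -> letter := if u.1 then pass_x else pass_v.
Local Notation insL := (insL mixed_act).
Local Notation insI := (insI mixed_act).

Definition letter_x : letter := (true, (0, 0)%N).
Definition letter_v (e : nat) : letter := (false, (e, 0)%N).

(** What can be seen of a letter if [x] may be an eigenvector of [g] and [v] is one
    of [h]. *)
Definition mixed_key (a : letter) : option nat := if a.1 then None else Some a.2.1.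

Definition pattern (t : seq letter) : seq bool := map fst t.
Definition v_degree (t : seq letter) : nat := sumn [seq odflt 0%N (mixed_key a) | a <- t].
Definition v_count (t : seq letter) : nat := count (fun a => ~~ a.1) t.

Fixpoint mixed_src (s : seq bool) : seq letter :=
  if s is e :: s' then [:: letter_x, letter_v e & mixed_src s'] else [::].

(** The contribution of the longest permutation. *)
Fixpoint mixed_top (s : seq bool) : seq letter :=
  if s is e :: s' then
    rcons (map pass_x (rcons (map pass_v (mixed_top s')) (letter_v e))) letter_x
  else [::].

Fixpoint vx_pattern (n : nat) : seq bool :=
  if n is n'.+1 then rcons (rcons (vx_pattern n') false) true else [::].

Lemma pattern_rcons t a : pattern (rcons t a) = rcons (pattern t) a.1.
Proof. exact: map_rcons. Qed.

Lemma pattern_pass_x t : pattern (map pass_x t) = pattern t.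
Proof. by rewrite /pattern -map_comp. Qed.

Lemma pattern_pass_v t : pattern (map pass_v t) = pattern t.
Proof. by rewrite /pattern -map_comp. Qed.

Lemma v_count_pass_x t : v_count (map pass_x t) = v_count t.
Proof. by rewrite /v_count count_map; exact: eq_count. Qed.

Lemma v_count_pass_v t : v_count (map pass_v t) = v_count t.
Proof. by rewrite /v_count count_map; exact: eq_count. Qed.

Lemma v_count_rcons t a : v_count (rcons t a) = (v_count t + ~~ a.1)%N.
Proof. by rewrite /v_count -cats1 count_cat /= addn0. Qed.

Lemma v_degree_rcons t a :
  v_degree (rcons t a) = (v_degree t + odflt 0 (mixed_key a))%N.
Proof. by rewrite /v_degree map_rcons sumn_rcons. Qed.

Lemma v_degree_cons a t : v_degree (a :: t) = (odflt 0 (mixed_key a) + v_degree t)%N.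
Proof. by []. Qed.

Lemma v_degree_pass_x t : v_degree (map pass_x t) = (v_degree t + v_count t)%N.
Proof.
elim: t => //= -[b [i j]] t IHt; rewrite !v_degree_cons IHt /mixed_key.
by case: b => /=; lia.
Qed.

Lemma v_degree_pass_v t : v_degree (map pass_v t) = v_degree t.
Proof. by elim: t => //= a t IHt; rewrite !v_degree_cons IHt. Qed.

Lemma v_count0 t : v_count t = 0%N -> pattern t = nseq (size t) true.
Proof. by elim: t => //= -[[] p] t IHt //= /IHt ->. Qed.

(** An [x] that jumps over all the [v]s, but not to the very end, is followed only by
    letters [x]. *)
Lemma insI_x t t' : t' \in insI letter_x t ->
  (v_degree t' <= v_degree t + v_count t)%N /\
  (v_degree t' = v_degree t + v_count t -> exists w, pattern t' = w ++ [:: true; true])%N.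
Proof.
elim: t t' => //= a t IHt t'; rewrite inE => /predU1P[->|/mapP[t1 /IHt[le1 eq1] ->]].
  split=> [|dgE]; first by rewrite v_degree_cons add0n leq_addr.
  have /v_count0 patE : v_count (a :: t) = 0%N.
    by move: dgE; rewrite v_degree_cons add0n /v_count /=; lia.
  exists (nseq (size t) true); rewrite -[[:: true; true]]/(nseq 2 true) -nseqD addn2.
  by rewrite -[LHS]/(true :: pattern (a :: t)) patE.
have passE : odflt 0%N (mixed_key (pass_x a)) = (odflt 0%N (mixed_key a) + ~~ a.1)%N.
  by rewrite /mixed_key; case: a => -[] [i j] //=; lia.
rewrite !v_degree_cons [mixed_act _ _]/= passE /=; split=> [|dgE]; first lia.
have [|w wE] := eq1; first lia.
by exists (a.1 :: w); rewrite /= -wE.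
Qed.

Lemma insL_x t t' : t' \in insL letter_x t ->
  [/\ v_count t' = v_count t, (v_degree t' <= v_degree t + v_count t)%N &
      (v_degree t' = v_degree t + v_count t)%N -> last true (pattern t')].
Proof.
move=> tt'; split; last 2 first.
- move: tt'; rewrite insLE mem_rcons inE => /predU1P[->|/insI_x[]//].
  by rewrite v_degree_rcons v_degree_pass_x addn0.
- move: tt'; rewrite insLE mem_rcons inE => /predU1P[-> _|/insI_x[_] /[apply] -[w ->]].
    by rewrite pattern_rcons last_rcons.
  by rewrite last_cat.
elim: t t' tt' => [|a t IHt] t' /=; first by rewrite inE => /eqP ->.
rewrite inE => /predU1P[->|/mapP[t1 /IHt]]; first by rewrite /v_count /= add0n.
by rewrite /v_count => t1E -> /=; rewrite t1E.
Qed.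

Lemma insL_v e t t' : t' \in insL (letter_v e) t ->
  v_count t' = (v_count t).+1 /\ v_degree t' = (v_degree t + e)%N.
Proof.
elim: t t' => [|a t IHt] t' /=; first by rewrite inE => /eqP ->; split=> //;
  rewrite v_degree_cons addn0.
rewrite inE => /predU1P[->|/mapP[t1 /IHt[]]]; first by split; rewrite // v_degree_cons addnC.
rewrite /v_count => c1 d1 -> /=; rewrite c1 addnS; split=> //.
by rewrite !v_degree_cons d1 addnA.
Qed.

Lemma insI_v_last e t t' : t' \in insI (letter_v e) t ->
  last true (pattern t') = last true (pattern t).
Proof.
have insL_size u s s' : s' \in insI u s -> (1 < size s')%N.
  by elim: s s' => //= a s IHs s'; rewrite inE => /predU1P[->//|/mapP[s1 /IHs ? ->]] /=; lia.
elim: t t' => //= a t IHt t'; rewrite inE => /predU1P[->//|/mapP[t1 t1t ->]] /=.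
have := IHt _ t1t; have := insL_size _ _ _ t1t.
by case: t t1t {IHt} => // b t t1t; case: t1 t1t.
Qed.

Lemma v_count_mixed_top s : v_count (mixed_top s) = size s.
Proof.
elim: s => //= e s IHs; rewrite v_count_rcons v_count_pass_x v_count_rcons v_count_pass_v.
by rewrite IHs addn0 addn1.
Qed.

Lemma v_degree_mixed_top e s :
  v_degree (mixed_top (e :: s)) = (v_degree (mixed_top s) + e + (size s).+1)%N.
Proof.
rewrite /= v_degree_rcons v_degree_pass_x v_degree_rcons v_count_rcons v_degree_pass_v.
by rewrite v_count_pass_v v_count_mixed_top addn0 addn1.
Qed.

Lemma mixed_qterms s t : t \in qterms mixed_act (mixed_src s) ->
  [/\ v_count t = size s, (v_degree t <= v_degree (mixed_top s))%N &
      v_degree t = v_degree (mixed_top s) -> last true (pattern t)].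
Proof.
elim: s t => [|e s IHs] t; first by rewrite inE => /eqP ->.
case/qterms_cons=> t1 /qterms_cons[t0 /IHs[c0 d0 _] /insL_v[c1 d1]].
move=> /insL_x[c d l]; rewrite v_degree_mixed_top c c1 c0; split=> //; first lia.
by move=> dE; apply: l; lia.
Qed.

Lemma vx_pattern_trailing n w : vx_pattern n <> w ++ [:: true; true].
Proof.
case: n => [|n] /=; first by case: w.
by rewrite -[[:: true; true]]/(rcons [:: true] true) -rcons_cat cats1 => /rcons_inj[/rcons_inj[]].
Qed.

Lemma pattern_mixed_top s : pattern (mixed_top s) = vx_pattern (size s).
Proof.
elim: s => //= e s IHs.
by rewrite pattern_rcons pattern_pass_x pattern_rcons pattern_pass_v IHs.
Qed.

Lemma big_insL_x (U : nmodType) (F : seq letter -> U) n t :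
  \sum_(t' <- insL letter_x t | (pattern t' == vx_pattern n) &&
      (v_degree t' == (v_degree t + v_count t)%N)) F t' =
  if rcons (pattern t) true == vx_pattern n then F (rcons (map pass_x t) letter_x)
  else 0.
Proof.
rewrite big_mkcond insLE -cats1 big_cat big_seq1 big_seq big1 => [|t' /insI_x[_]].
  rewrite [LHS]add0r -[map _ t]/(map pass_x t).
  by rewrite pattern_rcons pattern_pass_x v_degree_rcons v_degree_pass_x addn0 eqxx andbT.
by case: eqP => //= patE; case: eqP => // _ [] // w; rewrite patE => /vx_pattern_trailing.
Qed.

(** For the largest degree the leftmost [x] has to end up behind all the letters [v],
    hence last by the pattern [vx...vx], and then the leftmost [v] comes directly before
    it, since a term of [mixed_src s] of the largest degree ends with an [x]. *)
Lemma big_mixed_top (U : nmodType) (F : seq letter -> U) s :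
  \sum_(t <- qterms mixed_act (mixed_src s) | (pattern t == vx_pattern (size s)) &&
      (v_degree t == v_degree (mixed_top s))) F t = F (mixed_top s).
Proof.
elim: s F => [|e s IHs] F; first by rewrite big_mkcond big_seq1.
rewrite big_mkcond 2!big_qterms_cons.
rewrite -[RHS](IHs (fun t => F (rcons (map pass_x (rcons (map pass_v t) (letter_v e))) letter_x))).
rewrite [RHS]big_mkcond !big_seq; apply: eq_bigr => t0 /mixed_qterms[c0 d0 l0].
rewrite v_degree_mixed_top.
transitivity (\sum_(t1 <- insL (letter_v e) t0)
    if (v_degree t0 == v_degree (mixed_top s)) && (pattern t1 == rcons (vx_pattern (size s)) false)
    then F (rcons (map pass_x t1) letter_x) else 0).
  rewrite !big_seq; apply: eq_bigr => t1 t01; have [c1 d1] := insL_v t01.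
  rewrite -big_mkcond; case: eqP => [dE|dN] /=; last first.
    rewrite big_seq_cond big1 // => t2 /andP[/insL_x[_ d2 _]] /andP[_ /eqP dE].
    by exfalso; lia.
  have -> : (v_degree (mixed_top s) + e + (size s).+1 = v_degree t1 + v_count t1)%N by lia.
  by rewrite [LHS](big_insL_x F (size s).+1) /= eqseq_rcons andbT.
rewrite insLE -cats1 big_cat big_seq1 big_seq big1 => [|t1 t01].
  rewrite [LHS]add0r -[map _ t0]/(map pass_v t0).
  by rewrite pattern_rcons pattern_pass_v eqseq_rcons andbT andbC.
case: eqP => //= dE; case: eqP => // patE; have := insI_v_last t01.
by rewrite patE last_rcons (l0 dE).
Qed.

Lemma mixed_top_key_inj s1 s2 : size s1 = size s2 ->
  map mixed_key (mixed_top s1) = map mixed_key (mixed_top s2) -> s1 = s2.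
Proof.
have keyx t : map mixed_key (map pass_x t) = map (omap S) (map mixed_key t).
  by rewrite -!map_comp; apply: eq_map => -[[] [i j]].
have keyv t : map mixed_key (map pass_v t) = map mixed_key t.
  by rewrite -!map_comp; apply: eq_map => -[[] [i j]].
elim: s1 s2 => [|e1 s1 IHs] [|e2 s2] //= [sz].
rewrite !map_rcons !keyx !keyv => /rcons_inj[/rcons_inj[/inj_map inj e12]].
congr (_ :: _); first by move: e12; case: e1; case: e2.
by apply: IHs => //; apply: inj => -[i|] [j|] // [->].
Qed.

Lemma v_degree_mixed_top_le s : (v_degree (mixed_top s) <= size s + size s * size s)%N.
Proof.
elim: s => // e s IHs; rewrite v_degree_mixed_top /=.
by case: e; lia.
Qed.

Lemma le_v_degree t a : a \in t -> ~~ a.1 -> (a.2.1 <= v_degree t)%N.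
Proof.
elim: t => //= b t IHt; rewrite inE v_degree_cons => /predU1P[->|/IHt]; last lia.
by rewrite /mixed_key => /negbTE -> /=; lia.
Qed.

Lemma mixed_key_pattern t1 t2 : map mixed_key t1 = map mixed_key t2 ->
  pattern t1 = pattern t2 /\ v_degree t1 = v_degree t2.
Proof.
have pk t : pattern t = [seq o == None | o <- map mixed_key t].
  by rewrite -map_comp; apply: eq_map => -[[] [i j]].
move=> kE; split; first by rewrite !pk kE.
by rewrite /v_degree !(map_comp (odflt 0%N) mixed_key) kE.
Qed.

End MixedAction.

Section MixedGrowth.
Context (R : realType) (k : fieldType) (G : zmodType) (V : ydModule k G).

Lemma yd_act_inj g : injective (yd_act V g).
Proof. by apply: can_inj (yd_act V (- g)) _ => v; rewrite -yd_actD addNr yd_act0. Qed.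

Lemma yd_act_eq0 g v : (yd_act V g v == 0) = (v == 0).
Proof. by rewrite -(inj_eq (@yd_act_inj g)) linear0. Qed.

Definition yd_proj g (v : V) : V := yd_dec v g.

Lemma yd_proj_linear g : linear (yd_proj g).
Proof. by move=> a u v; exact: yd_decZD. Qed.
HB.instance Definition _ g := GRing.isLinear.Build k V V _ (yd_proj g)
  (yd_proj_linear g).

Lemma yd_proj_homog g h v : yd_comp h v -> yd_proj g v = if g == h then v else 0.
Proof. by move=> vh; rewrite /yd_proj (yd_dec_homog vh) fsfunE inE. Qed.

Lemma GKdim_mixed_free (g h : G) (x v : V) (p : k) :
  countably_infinite_dim V -> g != h -> yd_comp g x -> x != 0 -> yd_comp h v ->
  yd_act V h v = p *: v -> lin_free (fun n : nat => yd_act V (g *+ n) v) ->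
  GKdim R (nichols (yd_braided V)) = +oo%E.
Proof.
move=> dV gh xg x0 vh hv fv.
have p0 : p != 0.
  apply/eqP => p0; have /eqP : yd_act V h v = 0 by rewrite hv p0 scale0r.
  rewrite yd_act_eq0 => /eqP ve.
  have := fv [:: 0%N] (fun=> 1) isT; rewrite big_seq1 ve linear0 scaler0.
  by move=> /(_ erefl 0%N); rewrite inE eqxx => /(_ isT)/eqP; rewrite oner_eq0.
pose f (a : bool * (nat * nat)) :=
  (if a.1 then g else h, yd_act V (g *+ a.2.1 + h *+ a.2.2) (if a.1 then x else v)).
have f_v i j : (f (false, (i, j))).2 = p ^+ j *: yd_act V (g *+ i) v.
  rewrite /f /= yd_actD -linearZ; congr (yd_act V _ _).
  elim: j => [|j IHj]; first by rewrite mulr0n yd_act0 expr0 scale1r.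
  by rewrite mulrS yd_actD IHj linearZ /= hv scalerA exprSr.
have homf a : homog (f a) by rewrite /homog /f; case: a => -[] [i j]; exact: yd_comp_act.
have projv i j : yd_proj h (f (false, (i, j))).2 = p ^+ j *: yd_act V (g *+ i) v.
  by rewrite -f_v (yd_proj_homog _ (homf (false, (i, j)))) eqxx.
apply: (@nichols_GKdim_exponential _ _ _ _ [:: x; v; yd_act V g v]
  (fun b => [seq (f a).2 | a <- mixed_src b])) => [b|m].
  split=> [|y]; first by elim: b => //= e b; rewrite size_map => /leq_ltn_trans; exact.
  elim: b => //= e b IHb; rewrite !inE /f /= !mulr0n !addr0 yd_act0.
  move=> /predU1P[->|/predU1P[->|/IHb]]; rewrite ?eqxx //.
    by case: e; rewrite ?mulr0n ?mulr1n ?yd_act0 eqxx ?orbT.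
  by rewrite !inE.
have -> : (fun b : m.-tuple bool =>
      qsym (yd_braiding V) (tword [seq (f a).2 | a <- mixed_src b])) =
    (fun b => qsym (yd_braiding V) (lword (map f (mixed_src b)))).
  by apply/funext => b; rewrite /lword -map_comp.
pose M := (m + m * m).+1.
have [phi phiE] := dual_seq M dV fv.
have /choice[chi chiE] (a : bool * (nat * nat)) :
    exists chi : {linear V -> k^o}, a.1 -> chi (f a).2 = 1.
  case: a => -[] p'; last by exists (phi 0%N).
  have [|chi chi1] := @dual_vector _ _ (f (true, p')).2 dV; last by exists chi.
  by rewrite yd_act_eq0.
pose psi (a : bool * (nat * nat)) : {linear V -> k^o} :=
  if a.1 then (chi a \o yd_proj g)%FUN : {linear V -> k^o}
  else (phi a.2.1 \o yd_proj h)%FUN : {linear V -> k^o}.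
have letter_lt b t a : size b = m -> t \in qterms mixed_act (mixed_src b) ->
    a \in t -> ~~ a.1 -> (a.2.1 < M)%N.
  move=> bm /mixed_qterms[_ tb _] /le_v_degree /[apply] at_.
  by rewrite ltnS (leq_trans at_) // (leq_trans tb) // -bm v_degree_mixed_top_le.
have top_lt b a : size b = m -> a \in mixed_top b -> ~~ a.1 -> (a.2.1 < M)%N.
  move=> bm /le_v_degree /[apply] at_.
  by rewrite ltnS (leq_trans at_) // -bm v_degree_mixed_top_le.
apply: (@leading_term_free _ _ _ _ _ mixed_act f mixed_key
  (fun t => pattern t == vx_pattern m) v_degree m mixed_src mixed_top psi) => //.
- move=> u a; rewrite /letter_act /f /mixed_act; case: (u.1) => /=.
    by rewrite -yd_actD mulrS addrA.
  by rewrite -yd_actD mulrS addrCA.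
- by move=> t1 t2 /mixed_key_pattern[-> ->].
- by move=> b <-; rewrite pattern_mixed_top.
- by move=> b1 b2 b1m b2m; apply: mixed_top_key_inj; rewrite b1m.
- by move=> b t _ /mixed_qterms[].
- by move=> b F <-; exact: big_mixed_top.
- move=> b b' t a a' bm b'm tb atop a't.
  have := top_lt _ _ bm atop; have := letter_lt _ _ _ b'm tb a't.
  case: a a' {atop a't} => -[] [i j] [[] [i' j']] //=.
  + by rewrite (yd_proj_homog _ (homf (false, (i', j')))) /= (negbTE gh) linear0 eqxx.
  + by rewrite (yd_proj_homog _ (homf (true, (i', j')))) /= (eq_sym h) (negbTE gh) linear0 eqxx.
  + rewrite (projv i' j') linearZ /=.
    move=> /(_ isT) i'M /(_ isT) iM; rewrite phiE //.
    by case: (eqVneq i i') => [->//|_]; rewrite mulr0n scaler0 eqxx.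
- move=> b a bm atop; have := top_lt _ _ bm atop; rewrite /psi; case: a {atop} => -[] [i j] /=.
    by rewrite (yd_proj_homog _ (homf (true, (i, j)))) /= eqxx chiE // oner_eq0.
  rewrite (projv i j) linearZ /= => /(_ isT) iM.
  by rewrite phiE // eqxx scaler_eq0 oner_eq0 orbF expf_eq0 (negbTE p0) andbF.
Qed.

End MixedGrowth.

(** * Finite GK-dimension makes every degree act locally finitely *)

Section PolynomialAction.
Context (k : fieldType) (G : zmodType) (V : ydModule k G).

Definition yd_poly (g : G) (p : {poly k}) (v : V) : V :=
  pcomb (fun n => yd_act V (g *+ n) v) p.

Lemma yd_poly_linear g p : linear (yd_poly g p).
Proof.
move=> a u v; rewrite /yd_poly /pcomb scaler_sumr -big_split /=.
by apply: eq_bigr => i _; rewrite linearP scalerDr !scalerA mulrC.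
Qed.
HB.instance Definition _ g p := GRing.isLinear.Build k V V _ (yd_poly g p)
  (yd_poly_linear g p).

Lemma yd_polyDZ g a p q v :
  yd_poly g (a *: p + q) v = a *: yd_poly g p v + yd_poly g q v.
Proof. exact: pcomb_linear. Qed.

Lemma yd_polyC g c v : yd_poly g c%:P v = c *: v.
Proof.
by rewrite /yd_poly (@pcombE _ _ 1) ?size_polyC_leq1 // big_ord1 coefC mulr0n yd_act0.
Qed.

Lemma yd_polyMX g p v : yd_poly g (p * 'X) v = yd_act V g (yd_poly g p v).
Proof.
rewrite /yd_poly (@pcombE _ _ (size p).+1); last first.
  by rewrite (leq_trans (size_polyMleq _ _)) // size_polyX addn2.
rewrite big_ord_recl coefMX scale0r add0r linear_sum; apply: eq_bigr => i _ /=.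
by rewrite coefMX /= linearZ /= mulrS yd_actD.
Qed.

Lemma yd_polyMXaddC g p c v :
  yd_poly g (p * 'X + c%:P) v = yd_act V g (yd_poly g p v) + c *: v.
Proof. by rewrite -[_ * _]scale1r yd_polyDZ scale1r yd_polyMX yd_polyC. Qed.

Lemma yd_actC g h v : yd_act V g (yd_act V h v) = yd_act V h (yd_act V g v).
Proof. by rewrite -!yd_actD addrC. Qed.

Lemma yd_poly_act g h p v : yd_poly g p (yd_act V h v) = yd_act V h (yd_poly g p v).
Proof.
rewrite /yd_poly /pcomb linear_sum; apply: eq_bigr => i _.
by rewrite linearZ /= yd_actC.
Qed.

Lemma yd_polyM g p q v : yd_poly g (p * q) v = yd_poly g p (yd_poly g q v).
Proof.
elim/poly_ind: p => [|p c IHp]; first by rewrite mul0r -polyC0 !yd_polyC !scale0r.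
rewrite yd_polyMXaddC mulrDl mulrAC -[_ * 'X]scale1r yd_polyDZ scale1r yd_polyMX IHp.
by rewrite mul_polyC -[c *: q]addr0 yd_polyDZ -polyC0 yd_polyC scale0r addr0.
Qed.

Lemma yd_polyXn g n v : yd_poly g 'X^n v = yd_act V (g *+ n) v.
Proof.
elim: n v => [|n IHn] v; first by rewrite expr0 yd_polyC scale1r mulr0n yd_act0.
by rewrite exprSr yd_polyMX IHn mulrS yd_actD.
Qed.

Lemma yd_poly_comp g h p v : yd_comp h v -> yd_comp h (yd_poly g p v).
Proof.
move=> vh; apply: subspace_sum => [|i _]; first exact: yd_comp_subspace.
by apply: (subspaceZ _ (yd_comp_subspace V h)); exact: yd_comp_act.
Qed.

Definition torsion g v := exists2 p : {poly k}, p != 0 & yd_poly g p v = 0.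

Lemma not_torsion_lin_free g v :
  ~ torsion g v -> lin_free (fun n => yd_act V (g *+ n) v).
Proof.
move=> nt; apply: pcomb_lin_free => p p0; apply/eqP; apply: contrapT => /negP pn0.
by apply: nt; exists p.
Qed.

End PolynomialAction.

Section Torsion.
Context (R : realType) (k : closedFieldType) (G : zmodType) (V : ydModule k G).

(** If [h] is algebraic on [v] and [g] acts freely on [v], then some eigenvector of [h]
    generates a free [g]-orbit: splitting off one root [z] of an annihilator of [v] at a
    time, either [(h - z) v] is still free, or a polynomial in [g] kills it and maps [v]
    into the eigenspace for [z]. *)
Lemma torsion_eigenvector (g h : G) (d : G) (v : V) :
  yd_comp d v -> torsion h v -> ~ torsion g v ->
  exists w (z : k), [/\ yd_comp d w, yd_act V h w = z *: w & ~ torsion g w].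
Proof.
move=> vd [p p0 pv0]; have [r rE] := closed_field_poly_normal p.
have : yd_poly h (\prod_(z <- r) ('X - z%:P)) v = 0.
  move: pv0; rewrite {1}rE -mul_polyC yd_polyM yd_polyC => /eqP.
  by rewrite scaler_eq0 lead_coef_eq0 (negbTE p0) => /eqP.
elim: r v vd {p p0 pv0 rE} => [|z r IHr] v vd.
  rewrite big_nil yd_polyC scale1r => v0; case; exists 1; first exact: oner_neq0.
  by rewrite yd_polyC v0 scaler0.
have XzE w : yd_poly h ('X - z%:P) w = yd_act V h w - z *: w.
  by rewrite -polyCN -['X]mul1r yd_polyMXaddC yd_polyC scale1r scaleNr.
rewrite big_cons mulrC yd_polyM; set u := yd_poly h _ v => ru nv.
have [[q q0 qu]|nu] := pselect (torsion g u); last exact: IHr (yd_poly_comp _ _ vd) ru nu.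
exists (yd_poly g q v), z; split; first exact: yd_poly_comp.
  apply/eqP; rewrite -subr_eq0 -yd_poly_act -linearZ -linearB /= -XzE; exact/eqP.
by case=> s s0; rewrite -yd_polyM => sqv; apply: nv; exists (s * q); rewrite ?mulf_neq0.
Qed.

Lemma GKdim_free (g h : G) (x v : V) :
  countably_infinite_dim V -> yd_comp g x -> x != 0 -> yd_comp h v -> ~ torsion g v ->
  GKdim R (nichols (yd_braided V)) = +oo%E.
Proof.
move=> dV xg x0 vh ngv; have [gh|gh] := eqVneq g h.
  by apply: (GKdim_self_free _ dV vh); apply: not_torsion_lin_free; rewrite -gh.
have [hv|nhv] := pselect (torsion h v); last first.
  exact: GKdim_self_free dV vh (not_torsion_lin_free nhv).
have [w [z [wh hw ngw]]] := torsion_eigenvector vh hv ngv.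
exact: GKdim_mixed_free dV gh xg x0 wh hw (not_torsion_lin_free ngw).
Qed.

End Torsion.

(** * Finite-dimensional braided subspaces *)

Section StableSpans.
Context (k : fieldType) (G : zmodType) (V : ydModule k G).

Definition stable g (W : set V) : Prop :=
  forall u, W u -> W (yd_act V g u) /\ W (yd_act V (- g) u).

(** A common annihilator with a nonzero constant term expresses [g^-1] on its kernel
    as a polynomial in [g]. *)
Lemma common_annihilator g (L : seq V) : (forall w, w \in L -> torsion g w) ->
  exists p c, c != 0 /\ forall w, w \in L -> yd_poly g (p * 'X + c%:P) w = 0.
Proof.
move=> tL; have [p p0 pL] : exists2 p : {poly k}, p != 0 &
    forall w, w \in L -> yd_poly g p w = 0.
  elim: L tL => [|v L IHL] tL; first by exists 1; rewrite ?oner_neq0.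
  have [|p p0 pL] := IHL; first by move=> w wL; apply: tL; rewrite inE wL orbT.
  have [q q0 qv] : torsion g v by apply: tL; rewrite inE eqxx.
  exists (p * q); first by rewrite mulf_neq0.
  move=> w; rewrite inE => /predU1P[->|/pL pw]; first by rewrite yd_polyM qv linear0.
  by rewrite mulrC yd_polyM pw linear0.
elim/poly_ind: p p0 pL => [|p c IHp]; first by rewrite eqxx.
have [-> pX0 pL|c0 _ pL] := eqVneq c 0; last by exists p, c.
apply: IHp => [|w /pL]; first by apply: contraNneq pX0 => ->; rewrite mul0r addr0.
by rewrite yd_polyMXaddC scale0r addr0 => /eqP; rewrite yd_act_eq0 => /eqP.
Qed.

Definition homogeneous_in (D : seq G) (L : seq V) : Prop :=
  forall w, w \in L -> exists2 d, d \in D & yd_comp d w.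

Lemma stable_extension g (D : seq G) (L : seq V) :
  homogeneous_in D L -> (forall w, w \in L -> torsion g w) ->
  exists L' : seq V, [/\ {subset L <= L'}, homogeneous_in D L', stable g (span [set` L'])
    & forall h, stable h (span [set` L]) -> stable h (span [set` L'])].
Proof.
move=> hL /common_annihilator[p [c [c0 pL]]]; set P := p * 'X + c%:P in pL.
have P0 : P != 0.
  by apply/eqP => /(congr1 (coefp 0)) /=; rewrite coefD coefMX coefC add0r coef0; exact/eqP.
pose L' := [seq yd_act V (g *+ i) w | w <- L, i <- iota 0 (size P)].
have sL' : subspace (span [set` L']) by exact: span_subspace.
have polyL' q z : span [set` L] z -> span [set` L'] (yd_poly g q z).
  move=> zL; suff : [set z | span [set` L'] (yd_poly g q z)] z by [].
  apply: (span_min _ _ zL) => [|w /= wL].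
    split=> [|a u v /= Hu Hv]; rewrite /= ?linear0; first by case: sL'.
    by rewrite linearP; apply: sL'.2.
  rewrite [q](divp_eq q P) -[_ * P]scale1r yd_polyDZ scale1r yd_polyM pL // linear0 add0r.
  apply: subspace_sum => // i _; apply: (subspaceZ _ sL'); apply: sub_span.
  apply/allpairsP; exists (w, val i); split=> //=; rewrite mem_iota add0n /=.
  by rewrite (leq_trans (ltn_ord i)) // ltnW // ltn_modp.
have genL' (T : {linear V -> V}) :
    (forall w i, w \in L -> span [set` L'] (T (yd_act V (g *+ i) w))) ->
    forall u, span [set` L'] u -> span [set` L'] (T u).
  move=> TL' u uL'; suff : [set u | span [set` L'] (T u)] u by [].
  apply: (span_min _ _ uL') => [|_ /= /allpairsP[[w i] [/= wL _ ->]]]; last exact: TL'.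
  split=> [|a u1 u2 /= H1 H2]; rewrite /= ?linear0; first by case: sL'.
  by rewrite linearP; apply: sL'.2.
have inL w : w \in L -> span [set` L] w by move=> wL; exact: sub_span.
exists L'; split.
- move=> w wL; apply/allpairsP; exists (w, 0%N); split=> //=; last by rewrite mulr0n yd_act0.
  by rewrite mem_iota add0n size_poly_gt0.
- by move=> _ /allpairsP[[w i] [/= /hL[d dD wd] _ ->]]; exists d => //; exact: yd_comp_act.
- move=> u uL'; split; move: u uL'; apply: genL' => w i wL.
    by rewrite -yd_actD -mulrS -yd_polyXn; apply: polyL'; exact: inL.
  (* [g (p(g) u) = - c u] for [u = g^i w] *)
  have : yd_poly g P (yd_act V (g *+ i) w) = 0 by rewrite yd_poly_act pL // linear0.
  rewrite yd_polyMXaddC => /(congr1 (yd_act V (- g))); rewrite linear0 linearD -yd_actD.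
  rewrite addNr yd_act0 linearZ /= => /eqP; rewrite addrC addr_eq0 => /eqP cE.
  rewrite -[yd_act V (- g) _]scale1r -(mulVf c0) -scalerA cE -yd_polyXn -yd_polyM.
  apply: (subspaceZ _ sL'); rewrite -scaleN1r; apply: (subspaceZ _ sL').
  by apply: polyL'; exact: inL.
- move=> h hst u uL'; split; move: u uL'; apply: genL' => w i wL;
    by rewrite yd_actC -yd_polyXn; apply: polyL'; case: (hst _ (inL _ wL)).
Qed.

Lemma stable_closure (gs D : seq G) (L : seq V) : homogeneous_in D L ->
  (forall g h (w : V), g \in gs -> yd_comp h w -> torsion g w) ->
  exists L' : seq V, [/\ {subset L <= L'}, homogeneous_in D L' &
    forall g, g \in gs -> stable g (span [set` L'])].
Proof.
move=> hL; elim: gs => [|g gs IHgs] tgs; first by exists L; split.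
have [|L1 [LL1 hL1 stL1]] := IHgs.
  by move=> h d w hgs; apply: tgs; rewrite inE hgs orbT.
have [|L2 [L12 hL2 stg st2]] := @stable_extension g D L1 hL1.
  by move=> w /hL1[d _]; apply: tgs; rewrite inE eqxx.
exists L2; split=> // [w wL|h]; first exact/L12/LL1.
rewrite inE => /predU1P[->//|/stL1]; exact: st2.
Qed.

Lemma stable_braided_subspace (D : seq G) (L : seq V) : homogeneous_in D L ->
  (forall g, g \in D -> stable g (span [set` L])) ->
  braided_subspace (V := yd_braided V) (span [set` L]).
Proof.
move=> hL stL; set W := span _; have sW : subspace W by exact: span_subspace.
split=> //; set T := tens_sub _; have sT : subspace T by exact: span_subspace.
have pureT v w : W v -> W w -> T (pure v w).
  by move=> Wv Ww; apply: sub_span; exists v, w.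
apply/seteqP; split=> [_ [t Tt <-]|].
  suff : [set t | T (yd_braiding V t)] t by [].
  apply: (span_min _ _ Tt) => [|_ [v [w [Wv Ww ->]]]].
    split=> [|a t1 t2 /= H1 H2]; rewrite /= ?linear0; first by case: sT.
    by rewrite linearP; apply: sT.2.
  suff : [set v | T (yd_braiding V (pure v w))] v by [].
  apply: (span_min _ _ Wv) => [|u /= uL].
    split=> [|a v1 v2 /= H1 H2]; rewrite /=; last by rewrite pure_linl linearP; apply: sT.2.
    by rewrite (linear_fun0 (pure_linl w)) linear0; case: sT.
  have [d dD ud] := hL _ uL; have cE : yd_braiding V (pure u w) = _ := yd_braiding_homog w ud.
  rewrite -[X in T X]/(yd_braiding V (pure u w)) cE.
  by apply: pureT; [case: (stL d dD _ Ww)|exact: sub_span].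
apply: span_min => [|_ [v [w [Wv Ww ->]]]].
  split=> [|a _ _ [t1 T1 <-] [t2 T2 <-]]; first by exists 0; [case: sT|rewrite linear0].
  by exists (a *: t1 + t2); [exact: sT.2|rewrite linearP].
suff : [set w | [set yd_braiding V t | t in T] (pure v w)] w by [].
apply: (span_min _ _ Ww) => [|u /= uL].
  split=> [|a v1 v2 /= [t1 T1 t1E] [t2 T2 t2E]].
    by exists 0; [case: sT|rewrite (linear_fun0 (pure_linr v)) linear0].
  by exists (a *: t1 + t2); [exact: sT.2|rewrite pure_linr -t1E -t2E linearP].
have [d dD ud] := hL _ uL; exists (pure u (yd_act V (- d) v)).
  by apply: pureT; [exact: sub_span|case: (stL d dD _ Wv)].
by rewrite (yd_braiding_homog _ ud) -yd_actD addrN yd_act0.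
Qed.

(** Zero letters are discarded, because nothing is known about the action of a degree
    that does not occur in [V]. *)
Lemma fin_braided_cover (s : seq (G * V)) :
  (forall g h (x w : V), yd_comp g x -> x != 0 -> yd_comp h w -> torsion g w) ->
  homog_word s ->
  exists W, @fin_braided_subspaces _ (yd_braided V) W /\ forall a, a \in s -> W a.2.
Proof.
move=> tV hs; pose s' := [seq a <- s | a.2 != 0]; pose D := map fst s'.
have [|g h w /mapP[[g' x]]|L' [LL' hL' stL']] := @stable_closure D D (map snd s').
- move=> w /mapP[a as' ->]; exists a.1; first exact: map_f.
  by apply: hs; move: as'; rewrite mem_filter => /andP[].
- rewrite mem_filter => /andP[/= x0 /hs xg] -> wh; exact: tV xg x0 wh.
exists (span [set` L']); split; first split.
- exact: span_seq_fin_dim.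
- exact: stable_braided_subspace hL' stL'.
move=> a as_; have [->|a0] := eqVneq a.2 0; first by case: (span_subspace [set` L']).
by apply: sub_span; apply: LL'; rewrite map_f // mem_filter a0.
Qed.

Lemma homog_decomposition (v : V) : exists s : seq (G * V),
  homog_word s /\ v = \sum_(a <- s) a.2.
Proof.
have [vc vE] := yd_decP v.
exists [seq (g, yd_dec v g) | g <- enum_fset (finsupp (yd_dec v))].
by split=> [_ /mapP[g _ ->]|]; [exact: vc|rewrite big_map].
Qed.

Lemma torsion_locally_finite :
  (forall g h (x w : V), yd_comp g x -> x != 0 -> yd_comp h w -> torsion g w) ->
  locally_finite (yd_braided V).
Proof.
move=> tV; have cover (L : seq V) : exists W : set V,
    @fin_braided_subspaces _ (yd_braided V) W /\ forall v, v \in L -> W v.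
  have [dec decP] := choice homog_decomposition.
  have [|W [WF sW]] := fin_braided_cover (s := flatten (map dec L)) tV.
    by move=> a /flatten_mapP[v _]; exact: (decP v).1.
  exists W; split=> // v vL; rewrite (decP v).2 big_seq.
  apply: subspace_sum => [|a av]; first by case: WF => _ [].
  by apply: sW; apply/flatten_mapP; exists v.
split.
  apply/seteqP; split=> // v _; have [W [WF Wv]] := cover [:: v].
  by exists W => //; apply: Wv; rewrite inE.
move=> U W [[m [e [_ <-]]] _] [[n [e' [_ <-]]] _].
have [Z [ZF ZL]] := cover (codom e ++ codom e').
have sZ : subspace Z by case: ZF => _ [].
exists Z; split=> //; apply: span_min => // _ [i _ <-]; apply: ZL;
  by rewrite mem_cat codom_f ?orbT.
Qed.

End StableSpans.

Theorem theorem3p7 (R : realType) (k : closedFieldType)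
  (char0 : [pchar k]%R =i pred0) (G : zmodType) (V : ydModule k G)
  (dimV : countably_infinite_dim V)
  (gkV : (GKdim R (nichols (yd_braided V)) < +oo)%E) :
  locally_finite (yd_braided V).
Proof.
apply: torsion_locally_finite => g h x w xg x0 wh; apply: contrapT => ntw.
by move: gkV; rewrite (GKdim_free R dimV xg x0 wh ntw) ltxx.
Qed.
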